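(* Let $T$ be a tree of order $n\ge 3$. Then $T$ is a perfect Roman domination stable tree if and only if $T\in \mathcal{T}$.
   Context: All graphs are finite, simple (no loops or multiple edges). A perfect Roman dominating function (PRDF) on a graph $G=(V,E)$ is a function $f:V\to\{0,1,2\}$ such that every vertex $u$ with $f(u)=0$ is adjacent to exactly one vertex $v$ with $f(v)=2$. Its weight is $w(f)=\sum_{u\in V}f(u)$, and the perfect Roman domination number $\gamma_R^p(G)$ is the minimum weight of a PRDF on $G$; a PRDF of weight $\gamma_R^p(G)$ is a $\gamma_R^p$-function of $G$. A graph $G$ is perfect Roman domination stable if $\gamma_R^p(G-v)=\gamma_R^p(G)$ for every vertex $v\in V(G)$. For a tree $T$, let $W(T)=\{u\in V(T): f(u)=0 \text{ for every } \gamma_R^p\text{-function } f \text{ of } T\}$. The family $\mathcal{T}$ consists of all trees $T$ for which there is a sequence of trees $T_1,T_2,\ldots,T_k$ ($k\ge 1$) with $T_1=P_3$ (the path on 3 vertices), $T_k=T$, and, for each $1\le i<k$, $T_{i+1}$ is obtained from $T_i$ by the following Operation $\mathcal{O}_1$: choose a vertex $u\in W(T_i)$, add a new path $v_3v_2v_1$ (three new vertices) and the edge $uv_3$. *)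

(* Defs.v *)
From HB Require Import structures.
From mathcomp Require Import all_boot.

Set Implicit Arguments.
Unset Strict Implicit.
Unset Printing Implicit Defensive.

Record sgraph := SGraph {
  svertex :> finType;
  sedge : rel svertex;
  sg_sym : symmetric sedge;
  sg_irrefl : irreflexive sedge }.

Notation "x -- y" := (sedge x y) (at level 30).

Definition siso (G H : sgraph) : Prop :=
  exists2 h : G -> H, bijective h & forall x y : G, (h x -- h y) = (x -- y).

Definition connected (G : sgraph) : Prop :=
  0 < #|G| /\ forall x y : G, connect (@sedge G) x y.

(* [cycle] alone would accept [:: x; y] for an edge xy, hence the bound on the
   length. *)
Definition acyclic (G : sgraph) : Prop :=
  forall c : seq G, 2 < size c -> uniq c -> ~~ cycle (@sedge G) c.

Definition is_tree (G : sgraph) : Prop := connected G /\ acyclic G.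

Section Deletion.
Variables (G : sgraph) (v : G).

Definition del_edge : rel {x : G | x != v} := fun x y => val x -- val y.

Lemma del_edge_sym : symmetric del_edge.
Proof. by move=> x y; apply: sg_sym. Qed.

Lemma del_edge_irrefl : irreflexive del_edge.
Proof. by move=> x; apply: sg_irrefl. Qed.

Definition del_vertex : sgraph := SGraph del_edge_sym del_edge_irrefl.
End Deletion.

Section PathGraph.
Variable n : nat.

Definition path_edge : rel 'I_n :=
  fun i j => (i.+1 == j :> nat) || (j.+1 == i :> nat).

Lemma path_edge_sym : symmetric path_edge.
Proof. by move=> i j; rewrite /path_edge orbC. Qed.

Lemma path_edge_irrefl : irreflexive path_edge.
Proof. by move=> i; rewrite /path_edge orbb gtn_eqF. Qed.

Definition path_graph : sgraph := SGraph path_edge_sym path_edge_irrefl.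
End PathGraph.

Section AddPath.
Variables (G : sgraph) (u : G).

(* The new vertices v3, v2, v1 are inr 0, inr 1, inr 2. *)
Definition add_path3_edge : rel (G + 'I_3)%type := fun x y =>
  match x, y with
  | inl a, inl b => a -- b
  | inl a, inr i | inr i, inl a => (a == u) && (i == ord0)
  | inr i, inr j => path_edge i j
  end.

Lemma add_path3_edge_sym : symmetric add_path3_edge.
Proof. by move=> [a|i] [b|j] //=; [apply: sg_sym | apply: path_edge_sym]. Qed.

Lemma add_path3_edge_irrefl : irreflexive add_path3_edge.
Proof. by move=> [a|i] /=; [apply: sg_irrefl | apply: path_edge_irrefl]. Qed.

Definition add_path3 : sgraph :=
  SGraph add_path3_edge_sym add_path3_edge_irrefl.
End AddPath.

Section PerfectRomanDomination.
Variable G : sgraph.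
Implicit Type f : {ffun G -> 'I_3}.

Definition prdf f : bool :=
  [forall u, (f u == 0 :> nat) ==>
    (#|[set v : G | (u -- v) && (f v == 2 :> nat)]| == 1)].

Definition weight f : nat := \sum_(u : G) f u.

Lemma ex_prdf_weight : exists w, [exists f, prdf f && (weight f == w)].
Proof.
pose f := [ffun _ : G => Ordinal (isT : 1 < 3)].
exists (weight f); apply/existsP; exists f; rewrite eqxx andbT.
by apply/forallP=> u; rewrite ffunE.
Qed.

Definition prd_number : nat := ex_minn ex_prdf_weight.

Definition min_prdf f : bool := prdf f && (weight f == prd_number).

Definition always0 : {set G} :=
  [set u | [forall f, min_prdf f ==> (f u == 0 :> nat)]].
End PerfectRomanDomination.

Definition prd_stable (G : sgraph) : Prop :=
  forall v : G, prd_number (del_vertex v) = prd_number G.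

Definition operation1 (G H : sgraph) : Prop :=
  exists2 u : G, u \in always0 G & siso H (add_path3 u).

(* Graphs are identified up to isomorphism; S 0 is irrelevant. *)
Definition family_T (T : sgraph) : Prop :=
  exists k (S : nat -> sgraph),
    [/\ 1 <= k,
        forall i, 1 <= i <= k -> is_tree (S i),
        siso (S 1) (path_graph 3),
        siso (S k) T
      & forall i, 1 <= i < k -> operation1 (S i) (S i.+1)].

(* Main.v *)
(* Write gam A for the perfect Roman domination number of the subgraph induced
   by A, and C for what remains of a tree T after removing a pendant path
   v1 v2 v3 attached to u.  Such a path contributes at least 2 to gam, and
   exactly 2 as soon as some optimal function on C avoids the value 2 at u.

   Operation O1 preserves stability: along the construction there is an optimal
   function whose nonzero values bound the degrees of their vertices.  If it
   vanishes at a deleted vertex v, its restriction still works; otherwise one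
   trades its value at v for ones on the neighbours of v.  Hence
   gam (T - v) <= gam T; the converse inequality follows from the pendant path
   and from u in W(C).

   Conversely let T be stable.  No optimal function takes the value 1, since
   deleting the vertex would save 1; so leaves have value 0 and their neighbours
   value 2.  Root T at a leaf and let v1 v2 v3 e begin the path from a deepest
   vertex v1 to the root.  Then v3 has value 0 and no neighbours but v2 and e.
   If v1 is the only leaf at v2, the pendant path can be removed and C is again
   stable.  Otherwise an optimal function of T - v2 must take the value 2 at e;
   rearranging it around e yields an optimal function of T with a value 1, a
   contradiction. *)

Require Import Defs.
From mathcomp Require Import all_boot zify.

Set Implicit Arguments.
Unset Strict Implicit.
Unset Printing Implicit Defensive.

(** * Induced subgraphs and functions on vertex sets *)

Definition induced_edge (G : sgraph) (A : {set G}) : rel {x : G | x \in A} :=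
  fun x y => val x -- val y.

Lemma induced_sym (G : sgraph) (A : {set G}) : symmetric (@induced_edge G A).
Proof. by move=> x y; apply: sg_sym. Qed.

Lemma induced_irrefl (G : sgraph) (A : {set G}) :
  irreflexive (@induced_edge G A).
Proof. by move=> x; apply: sg_irrefl. Qed.

Definition induced (G : sgraph) (A : {set G}) : sgraph :=
  SGraph (@induced_sym G A) (@induced_irrefl G A).

(** An isomorphism of [H] onto the subgraph induced by [A]. Vertex deletions, induced subgraphs and
    isomorphic copies can then all be handled as vertex sets of one host graph. *)
Definition embedding (H G : sgraph) (h : H -> G) (A : {set G}) : Prop :=
  [/\ injective h, forall x y, (h x -- h y) = (x -- y)
    & forall y, y \in A <-> exists x, y = h x].

(* Values above 2 are allowed; they behave like 1, so minimal weights are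
   unaffected. *)
Definition prd_on (G : sgraph) (A : {set G}) (f : G -> nat) : Prop :=
  forall u, u \in A -> f u = 0 -> exists w,
    [/\ w \in A, u -- w, f w = 2
      & forall w', w' \in A -> u -- w' -> f w' = 2 -> w' = w].

Definition wt (G : sgraph) (A : {set G}) (f : G -> nat) : nat :=
  \sum_(x in A) f x.

Definition gam (G : sgraph) (A : {set G}) : nat := prd_number (induced A).

Definition opt (G : sgraph) (A : {set G}) (f : G -> nat) : Prop :=
  prd_on A f /\ wt A f = gam A.

(** * Perfect Roman domination on induced subgraphs *)

Section Transport.

Lemma prdfP (G : sgraph) (f : {ffun G -> 'I_3}) :
  reflect (prd_on [set: G] (fun x => f x)) (prdf f).
Proof.
apply: (iffP forallP) => [P u _ fu0|P u]; last first.
  apply/implyP=> /eqP fu0; have [//|w [_ uw fw uniq_w]] := P u _ fu0.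
  apply/cards1P; exists w; apply/setP=> v; rewrite !inE.
  apply/andP/eqP => [[uv /eqP fv]|->]; last by rewrite fw.
  exact: uniq_w.
have /implyP/(_ (introT eqP fu0))/cards1P[w Ew] := P u.
have : w \in [set v | (u -- v) && (f v == 2 :> nat)] by rewrite Ew set11.
rewrite inE => /andP[uw /eqP fw]; exists w; split=> // w' _ uw' fw'.
by apply/set1P; rewrite -Ew inE uw' fw'.
Qed.

(** Replacing every value above 2 by 1 keeps all zeros and all twos, hence the domination condition,
    and does not increase the weight. *)
Lemma prd_number_le (G : sgraph) (f : G -> nat) :
  prd_on [set: G] f -> prd_number G <= wt [set: G] f.
Proof.
move=> Pf; pose t n := if n <= 2 then n else 1.
have t_lt n : t n < 3 by rewrite /t; case: ifP.
pose F := [ffun x => Ordinal (t_lt (f x))] : {ffun G -> 'I_3}.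
have t0 n : t n = 0 -> n = 0 by rewrite /t; case: ifP.
have t2 n : t n = 2 <-> n = 2 by rewrite /t; case: ifP; lia.
have PF : prdf F.
  apply/prdfP=> u _; rewrite ffunE /= => /t0 /(Pf u (in_setT u))[w [wA uw fw Uw]].
  exists w; split=> //; first by rewrite ffunE /=; apply/t2.
  by move=> w' ? ?; rewrite ffunE /= => /t2; apply: Uw.
rewrite /prd_number; case: ex_minnP => m _ /(_ (weight F)).
move/(_ (introT existsP (ex_intro _ F _))) => le_m.
apply: leq_trans (le_m _) _; first by rewrite PF eqxx.
rewrite /weight /wt [leqRHS](eq_bigl xpredT) => [|x]; last by rewrite in_setT.
by apply: leq_sum => x _; rewrite ffunE /= /t; case: ifP; lia.
Qed.

Lemma ex_min_prdf (G : sgraph) : exists F : {ffun G -> 'I_3}, min_prdf F.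
Proof.
rewrite /min_prdf /prd_number; case: ex_minnP => m /existsP[F /andP[PF wF]] _.
by exists F; rewrite PF wF.
Qed.

Lemma weightE (G : sgraph) (F : {ffun G -> 'I_3}) :
  weight F = wt [set: G] (fun x => F x).
Proof. by apply: eq_bigl => x; rewrite in_setT. Qed.

Variables (H G : sgraph) (h : H -> G) (A : {set G}).
Hypothesis hA : embedding h A.

Lemma prd_on_embedding f : prd_on A f <-> prd_on [set: H] (f \o h).
Proof.
have [h_inj hE memA] := hA; split=> P u uA /= fu0.
  have [|w [/memA[z ->] uz fz Uz]] := P (h u) _ fu0; first by apply/memA; exists u.
  exists z; split; rewrite -?hE // => z' _ uz' fz'; apply: h_inj.
  by apply: Uz; rewrite ?hE //; apply/memA; exists z'.
move/memA: uA fu0 => [x ->] fx0; have [//|w [_ xw fw Uw]] := P x _ fx0.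
exists (h w); split; rewrite ?hE //; first by apply/memA; exists w.
by move=> _ /memA[w' ->]; rewrite hE => xw' fw'; rewrite (Uw w').
Qed.

Lemma wt_embedding f : wt A f = wt [set: H] (f \o h).
Proof.
have [h_inj _ memA] := hA; rewrite /wt.
have -> : A = h @: [set: H].
  apply/setP=> y; apply/idP/imsetP => [/memA[x ->]|[x _ ->]]; first by exists x.
  by apply/memA; exists x.
by rewrite big_imset //= => x y _ _; apply: h_inj.
Qed.

Lemma extend_embedding (F : H -> nat) : exists f : G -> nat, forall x, f (h x) = F x.
Proof.
have [h_inj _ _] := hA.
(* The value 0 off the image is arbitrary: [prd_on A] and [wt A] look only at [A]. *)
exists (fun y => if [pick x | h x == y] is Some x then F x else 0) => x.
by case: pickP => [z /eqP/h_inj -> //|/(_ x)]; rewrite eqxx.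
Qed.

End Transport.

Lemma prd_on_eq (G : sgraph) (A : {set G}) f g :
  f =1 g -> prd_on A f -> prd_on A g.
Proof.
move=> fg P u uA; rewrite -fg => /P[//|w [wA uw fw Uw]].
by exists w; split; rewrite -?fg // => w'; rewrite -fg; apply: Uw.
Qed.

Lemma eq_wt (G : sgraph) (A : {set G}) f g : f =1 g -> wt A f = wt A g.
Proof. by move=> fg; apply: eq_bigr => x _. Qed.

Lemma embedding_comp (K H G : sgraph) (k : K -> H) (h : H -> G) B A :
  embedding k B -> embedding h A -> embedding (h \o k) (h @: B).
Proof.
move=> [k_inj kE memB] [h_inj hE _]; split=> [|x y|y].
- exact: inj_comp.
- by rewrite /= hE kE.
split=> [/imsetP[x /memB[z ->] ->]|[z ->]]; first by exists z.
by apply/imsetP; exists (k z) => //; apply/memB; exists z.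
Qed.

Lemma embedding_val (G : sgraph) (A : {set G}) :
  @embedding (induced A) G val A.
Proof.
split=> // [|y]; first exact: val_inj.
split=> [yA|[x ->]]; last exact: valP.
by exists (exist _ y yA).
Qed.

Lemma embedding_del (G : sgraph) (v : G) :
  @embedding (del_vertex v) G val [set~ v].
Proof.
split=> // [|y]; first exact: val_inj.
rewrite !inE; split=> [yA|[x ->]]; last exact: (valP x).
by exists (exist _ y yA).
Qed.

Lemma embedding_id (G : sgraph) : @embedding G G id [set: G].
Proof. by split=> // y; rewrite in_setT; split=> // _; exists y. Qed.

Section Numbers.
Variables (H G : sgraph) (h : H -> G) (A : {set G}).
Hypothesis hA : embedding h A.

Lemma prd_number_embedding_le f : prd_on A f -> prd_number H <= wt A f.
Proof.
by rewrite (wt_embedding hA) (prd_on_embedding hA) => /prd_number_le.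
Qed.

Lemma ex_prd_number_embedding :
  exists2 f, prd_on A f & wt A f = prd_number H.
Proof.
have [F /andP[/prdfP PF /eqP wF]] := ex_min_prdf H.
have [f Ef] := extend_embedding hA (fun x => F x).
exists f.
  by apply/(prd_on_embedding hA); apply: prd_on_eq PF => x; rewrite /= Ef.
by rewrite (wt_embedding hA) -wF weightE; apply: eq_wt => x; rewrite /= Ef.
Qed.
End Numbers.

Lemma gam_le (G : sgraph) (A : {set G}) f : prd_on A f -> gam A <= wt A f.
Proof. exact/prd_number_embedding_le/embedding_val. Qed.

Lemma ex_opt (G : sgraph) (A : {set G}) : exists f, opt A f.
Proof.
by have [f ? ?] := ex_prd_number_embedding (embedding_val A); exists f.
Qed.

Lemma prd_number_gam (H G : sgraph) (h : H -> G) (A : {set G}) :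
  embedding h A -> prd_number H = gam A.
Proof.
move=> hA; apply/eqP; rewrite eqn_leq; apply/andP; split.
  by have [f [Pf <-]] := ex_opt A; apply: (prd_number_embedding_le hA Pf).
by have [f Pf <-] := ex_prd_number_embedding hA; apply: gam_le.
Qed.

(** Deleting [x] from [H] amounts to removing [h x] from [A], so stability becomes a statement about
    subsets of [G]. *)
Lemma stable_gam (H G : sgraph) (h : H -> G) (A : {set G}) :
  embedding h A ->
  prd_stable H <-> forall v, v \in A -> gam (A :\ v) = gam A.
Proof.
move=> hA; have [h_inj _ memA] := hA.
have E x : prd_number (del_vertex x) = gam (A :\ h x).
  rewrite (prd_number_gam (embedding_comp (embedding_del x) hA)).
  congr gam; apply/setP=> y; rewrite !inE.
  apply/imsetP/andP => [[z]|[nyx /memA[z Ey]]].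
    rewrite !inE => nzx ->; rewrite inj_eq //; split=> //.
    by apply/memA; exists z.
  by exists z => //; rewrite !inE -(inj_eq h_inj) -Ey.
rewrite /prd_stable (prd_number_gam hA); split=> S v.
  by move/memA=> [x ->]; rewrite -E.
by rewrite E S //; apply/memA; exists v.
Qed.

(** * Weights and optimal functions *)

Lemma wt1 (G : sgraph) (x : G) f : wt [set x] f = f x.
Proof. by rewrite /wt big_set1. Qed.

Lemma wtID (G : sgraph) (A B : {set G}) f :
  wt A f = wt (A :&: B) f + wt (A :\: B) f.
Proof. by rewrite /wt (big_setID B). Qed.

Lemma wt_setD1 (G : sgraph) (A : {set G}) x f :
  x \in A -> wt A f = f x + wt (A :\ x) f.
Proof. by move=> xA; rewrite /wt (big_setD1 x). Qed.

Lemma eq_in_wt (G : sgraph) (A : {set G}) f g :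
  (forall x, x \in A -> f x = g x) -> wt A f = wt A g.
Proof. by move=> fg; apply: eq_bigr => x; apply: fg. Qed.

Lemma wt_ge_card (G : sgraph) (A : {set G}) f :
  (forall x, x \in A -> 0 < f x) -> #|A| <= wt A f.
Proof. by move=> f_gt0; rewrite -sum1_card; apply: leq_sum. Qed.

Definition upd (G : sgraph) (f : G -> nat) (S : {set G}) (k : nat) : G -> nat :=
  fun x => if x \in S then k else f x.

(** The old weight on [S] is added on the left rather than subtracted on the right, which avoids
    truncated subtraction. *)
Lemma wt_upd (G : sgraph) (A S : {set G}) f k :
  S \subset A -> wt A (upd f S k) + wt S f = wt A f + k * #|S|.
Proof.
move=> SA; rewrite !(wtID A S) (setIidPr SA).
have -> : wt S (upd f S k) = k * #|S|.
  rewrite mulnC -sum_nat_const; apply: eq_bigr => x xS.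
  by rewrite /upd xS.
have -> : wt (A :\: S) (upd f S k) = wt (A :\: S) f.
  by apply: eq_in_wt => x /setDP[_ /negPf xS]; rewrite /upd xS.
lia.
Qed.

Lemma wt_upd1 (G : sgraph) (A : {set G}) x f k :
  x \in A -> wt A (upd f [set x] k) + f x = wt A f + k.
Proof.
move=> xA; have := wt_upd f k (_ : [set x] \subset A).
by rewrite wt1 cards1 muln1 sub1set; apply.
Qed.

(** A value above 2 dominates nothing, so lowering it to 1 harms no vertex and saves weight. *)
Lemma opt_le2 (G : sgraph) (A : {set G}) f x : opt A f -> x \in A -> f x <= 2.
Proof.
move=> [Pf wf] xA; rewrite leqNgt; apply/negP=> fx.
have Pg : prd_on A (upd f [set x] 1).
  move=> u uA; rewrite /upd inE; case: eqP => // /eqP nuy fu0.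
  have [w [wA uw fw Uw]] := Pf u uA fu0; exists w; split=> //.
    by rewrite inE; case: eqP => // E; move: fw fx; rewrite E; lia.
  by move=> w' w'A uw'; rewrite inE; case: eqP => // _; apply: Uw.
have := gam_le Pg; have := wt_upd1 f 1 xA; lia.
Qed.

(** Optimal functions with natural values are at most 2 on [A], so they correspond to the finite
    functions quantified over in [always0]. *)
Lemma always0P (H G : sgraph) (h : H -> G) (A : {set G}) x :
  embedding h A ->
  x \in always0 H <-> forall f, opt A f -> f (h x) = 0.
Proof.
move=> hA; rewrite inE; split=> [/forallP W f [Pf wf]|W].
  have f_le2 y : f (h y) < 3.
    have [_ _ memA] := hA; rewrite ltnS (opt_le2 (conj Pf wf)) //.
    by apply/memA; exists y.
  pose F := [ffun y => Ordinal (f_le2 y)] : {ffun H -> 'I_3}.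
  have EF : (fun y => nat_of_ord (F y)) =1 f \o h by move=> y; rewrite ffunE.
  have /implyP/(_ _)/eqP := W F; rewrite (EF x); apply.
  rewrite /min_prdf weightE (eq_wt _ EF) -(wt_embedding hA) wf.
  rewrite -(prd_number_gam hA) eqxx andbT; apply/prdfP.
  by apply: prd_on_eq (proj1 (prd_on_embedding hA f) Pf) => y; rewrite EF.
apply/forallP=> F; apply/implyP=> /andP[/prdfP PF /eqP wF].
have [f Ef] := extend_embedding hA (fun x => F x).
have := W f; rewrite (Ef x) => -> //; split.
  by apply/(prd_on_embedding hA); apply: prd_on_eq PF => y; rewrite /= Ef.
by rewrite (wt_embedding hA) -(prd_number_gam hA) -wF weightE; apply: eq_wt => y; rewrite /= Ef.
Qed.

Lemma siso_embedding (H G : sgraph) :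
  siso H G -> exists h : H -> G, embedding h [set: G].
Proof.
move=> [h [k hk kh] hE]; exists h; split=> // [|y]; first exact: can_inj hk.
by rewrite in_setT; split=> // _; exists (k y).
Qed.

Lemma siso_sym (H G : sgraph) : siso H G -> siso G H.
Proof.
move=> [h [k hk kh] hE]; exists k; first by exists h.
by move=> x y; rewrite -hE !kh.
Qed.

(** * Pendant paths *)

Definition pendant (G : sgraph) (v1 v2 v3 u : G) : Prop :=
  [/\ uniq [:: v1; v2; v3; u], forall x, (v1 -- x) = (x == v2),
      forall x, (v2 -- x) = (x == v1) || (x == v3)
    & forall x, (v3 -- x) = (x == v2) || (x == u)].

Definition nbr_in (G : sgraph) (A : {set G}) (v : G) : {set G} :=
  [set w in A | v -- w].

Lemma prd_on_del (G : sgraph) (A : {set G}) f x :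
  prd_on A f -> f x <> 2 -> prd_on (A :\ x) f.
Proof.
move=> P fx v /setD1P[_ vA] fv; have [w [wA vw fw Uw]] := P v vA fv.
exists w; split=> //; last by move=> w' /setD1P[_ w'A]; apply: Uw.
by rewrite !inE wA andbT; apply/eqP=> E; rewrite E in fw.
Qed.

(** A vertex of value 1 neither needs domination nor provides any. *)
Lemma prd_on_upd1 (G : sgraph) (A : {set G}) f x :
  prd_on (A :\ x) f -> prd_on A (upd f [set x] 1).
Proof.
move=> P v vA; rewrite /upd inE; case: eqP => // /eqP nvx fv.
have [|w [/setD1P[nwx wA] vw fw Uw]] := P v _ fv; first by rewrite !inE nvx.
exists w; split=> //; first by rewrite inE (negPf nwx).
move=> w' w'A vw'.
by rewrite inE; case: eqP => // /eqP nw'x; apply: Uw => //; rewrite !inE nw'x.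
Qed.

(** If [f v] is 0, the restriction of [f] works. Otherwise the neighbours of [v] with value 0 are
    raised to 1; there are at most [f v] of them, and deleting [v] frees exactly [f v]. *)
Lemma gam_del_le (G : sgraph) (A : {set G}) f v :
  prd_on A f -> v \in A -> (f v <> 0 -> #|nbr_in A v| <= f v) ->
  gam (A :\ v) <= wt A f.
Proof.
move=> P vA dv; rewrite (wt_setD1 f vA).
have [fv|/eqP/dv le_dv] := eqVneq (f v) 0.
  by rewrite fv add0n; apply: gam_le; apply: prd_on_del => //; rewrite fv.
pose S := [set w in nbr_in A v | f w == 0].
have SA : S \subset A :\ v.
  apply/subsetP=> w; rewrite !inE -andbA => /and3P[-> vw _]; rewrite andbT.
  by apply/eqP=> E; move: vw; rewrite E sg_irrefl.
have cS : #|S| <= #|nbr_in A v|.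
  by apply: subset_leq_card; apply/subsetP=> w /setIdP[].
have wS : wt S f = 0.
  by apply: big1 => w /setIdP[_ /eqP].
have := wt_upd f 1 SA.
suff /gam_le : prd_on (A :\ v) (upd f S 1) by lia.
move=> x /setD1P[nxv xA]; rewrite /upd; case: ifP => // xS fx.
have [w [wA xw fw Uw]] := P x xA fx.
have nwv : w != v.
  by apply/eqP=> E; rewrite !inE xA fx eqxx -E sg_sym xw in xS.
have nS y : f y = 2 -> y \in S = false by move=> fy; rewrite !inE fy andbF.
exists w; rewrite nS // !inE nwv; split=> // w' /setD1P[_ w'A] xw'.
by case: ifP => // _; apply: Uw.
Qed.

(** Deleting a vertex of value 1 would leave a valid function that is cheaper by 1. *)
Lemma stable_opt_neq1 (G : sgraph) f x :
  (forall v : G, gam ([set: G] :\ v) = gam [set: G]) ->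
  prd_on [set: G] f -> wt [set: G] f <= gam [set: G] -> f x <> 1.
Proof.
move=> S P wf fx; have := wt_setD1 f (in_setT x).
suff /gam_le : prd_on ([set: G] :\ x) f by rewrite S; lia.
by apply: prd_on_del; rewrite ?fx.
Qed.

Section PendantPath.
Variables (G : sgraph) (v1 v2 v3 u : G).
Hypothesis Hp : pendant v1 v2 v3 u.
Let core := ~: [set v1; v2; v3].

Lemma pendant_neq :
  [/\ [/\ v1 != v2, v1 != v3 & v2 != v3], v1 != u, v2 != u & v3 != u].
Proof.
case: Hp => /=; rewrite !inE !negb_or.
by move=> /and4P[/and3P[-> -> ->] /andP[-> ->] -> _] _ _ _.
Qed.

Lemma coreP x : x \in core -> [/\ x != v1, x != v2 & x != v3].
Proof. by rewrite !inE !negb_or -andbA => /and3P[]. Qed.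

Lemma mem_core x : [\/ x = v1, x = v2, x = v3 | x \in core].
Proof.
have [->|n1] := eqVneq x v1; first by constructor 1.
have [->|n2] := eqVneq x v2; first by constructor 2.
have [->|n3] := eqVneq x v3; first by constructor 3.
by constructor 4; rewrite !inE (negPf n1) (negPf n2) (negPf n3).
Qed.

Lemma u_core : u \in core.
Proof.
have [_ n1 n2 n3] := pendant_neq.
by rewrite !inE !negb_or -andbA !(eq_sym u) n1 n2 n3.
Qed.

Lemma core_nbr x y : x \in core -> x -- y -> y \in core \/ x = u /\ y = v3.
Proof.
have [_ E1 E2 E3] := Hp; have [_ n1 n2 n3] := pendant_neq.
move=> /coreP[x1 x2 x3] xy; have [Ey|Ey|Ey|] := mem_core y; last by left.
- by move: xy; rewrite Ey sg_sym E1 (negPf x2).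
- by move: xy; rewrite Ey sg_sym E2 (negPf x1) (negPf x3).
by move: xy; rewrite Ey sg_sym E3 (negPf x2) => /eqP; right.
Qed.

(** The edge from [u] to [v3] is the only link between [core] and the path. Restriction therefore
    fails only if [u] was dominated by [v3], and raising [u] to 1 repairs it. *)
Lemma prd_on_core (A : {set G}) h : prd_on A h ->
  prd_on (A :&: core) h \/
  [/\ u \in A, h u = 0, v3 \in A, h v3 = 2
    & prd_on (A :&: core) (upd h [set u] 1)].
Proof.
move=> P.
have [/and4P[uA /eqP hu vA /eqP hv]|N] :=
  boolP [&& u \in A, h u == 0, v3 \in A & h v3 == 2].
  right; split=> // x /setIP[xA xC]; rewrite /upd !inE.
  case: eqP => // nxu hx; have [w [wA xw hw Uw]] := P x xA hx.
  have [wC|[]//] := core_nbr xC xw.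
  have nwu : w == u = false by apply/eqP => E; move: hw; rewrite E hu.
  exists w; rewrite [w \in _ :&: _]inE wA wC; split; rewrite ?inE ?nwu //.
  by move=> w' /setIP[w'A _] xw'; rewrite inE; case: eqP => // _; apply: Uw.
left=> x /setIP[xA xC] hx; have [w [wA xw hw Uw]] := P x xA hx.
exists w; split=> //; last by move=> w' /setIP[w'A _]; apply: Uw.
rewrite inE wA /=; have [//|[Ex Ew]] := core_nbr xC xw.
by move: N; rewrite -Ex -Ew xA hx wA hw.
Qed.

Lemma wt_core (A : {set G}) h : v1 \in A -> v2 \in A -> v3 \in A ->
  wt A h = wt (A :&: core) h + (h v1 + h v2 + h v3).
Proof.
have [[n12 n13 n23] _ _ _] := pendant_neq.
move=> A1 A2 A3; rewrite (wtID A core); congr (_ + _).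
have -> : A :\: core = v1 |: (v2 |: [set v3]).
  apply/setP=> x; rewrite !inE negbK -orbA; apply: andb_idr.
  by case/or3P=> /eqP->.
rewrite /wt !big_setU1 ?inE ?negb_or ?n12 ?n13 // big_set1 /=; lia.
Qed.

(** The path always weighs at least 2. If [v3] dominates [u] it weighs at least 3, and the surplus
    pays for raising [u] to 1. *)
Lemma gam_core_ge (A : {set G}) : v1 \in A -> v2 \in A -> v3 \in A ->
  gam (A :&: core) + 2 <= gam A.
Proof.
have [[n12 n13 n23] m1 m2 m3] := pendant_neq; have [_ E1 E2 E3] := Hp.
move=> A1 A2 A3; have [h [P <-]] := ex_opt A; rewrite (wt_core h A1 A2 A3).
have h1 : h v1 = 0 -> h v2 = 2.
  by move/(P _ A1) => [w [_]]; rewrite E1 => /eqP->.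
have h2 : h v2 = 0 -> h v1 = 2 \/ h v3 = 2.
  move/(P _ A2) => [w [_]]; rewrite E2 => /orP[]/eqP-> hw _; by [left|right].
have [/gam_le|[uA hu _ hv /gam_le]] := prd_on_core P.
  by clear -h1 h2; lia.
have := @wt_upd1 _ (A :&: core) u h 1; rewrite inE uA u_core => /(_ isT).
by clear -h1 hu hv; lia.
Qed.

(** The path receives 0, 2, 0. The value 2 at [u] is excluded because [v3] would then be dominated
    by both [v2] and [u]. *)
Lemma gam_core_le (A : {set G}) g : v1 \in A -> v2 \in A -> v3 \in A ->
  prd_on (A :&: core) g -> (u \in A -> g u <> 2) ->
  exists h, [/\ prd_on A h, wt A h = wt (A :&: core) g + 2,
    forall x, x \in core -> h x = g x & [/\ h v1 = 0, h v2 = 2 & h v3 = 0]].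
Proof.
have [[n12 n13 n23] m1 m2 m3] := pendant_neq; have [_ E1 E2 E3] := Hp.
move=> A1 A2 A3 P gu.
pose h := upd (upd g [set v1; v3] 0) [set v2] 2.
have hC x : x \in core -> h x = g x.
  move=> /coreP[x1 x2 x3].
  by rewrite /h /upd !inE (negPf x1) (negPf x2) (negPf x3).
have h1 : h v1 = 0 by rewrite /h /upd !inE (negPf n12) eqxx.
have h2 : h v2 = 2 by rewrite /h /upd !inE eqxx.
have h3 : h v3 = 0 by rewrite /h /upd !inE eqxx orbT eq_sym (negPf n23).
exists h; split=> //; last first.
  rewrite wt_core // h1 h2 h3; congr (_ + _); apply: eq_in_wt => x.
  by move=> /setIP[_]; apply: hC.
move=> x xA hx; have [Ex|Ex|Ex|xC] := mem_core x.
- exists v2; rewrite Ex E1 eqxx; split=> // w' _ + _.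
  by rewrite E1 => /eqP.
- by move: hx; rewrite Ex h2.
- exists v2; rewrite Ex E3 eqxx; split=> // w' w'A + hw'.
  rewrite E3 => /orP[]/eqP// Ew'; move: hw'.
  by rewrite Ew' hC ?u_core // => /gu; rewrite -Ew' => /(_ w'A).
have [||w [wA xw gw Uw]] := P x; first by rewrite inE xA xC.
  by rewrite -hC.
have [wA' wC] := setIP wA.
exists w; rewrite hC //; split=> // w' w'A xw'.
have [w'C|[_ ->]] := core_nbr xC xw'; last by rewrite h3.
by rewrite hC //; apply: Uw => //; rewrite inE w'A w'C.
Qed.


Lemma setTD_core v : v \notin core -> ([set: G] :\ v) :&: core = core.
Proof.
move=> vC; apply/setP=> x; rewrite in_setI in_setD1 in_setT andbT.
by apply: andb_idl => xC; apply: contra vC => /eqP <-.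
Qed.

Lemma pend_notin : [/\ v1 \notin core, v2 \notin core & v3 \notin core].
Proof. by rewrite !inE !eqxx !orbT. Qed.

Lemma pendant_stable_core :
  (forall v, gam ([set: G] :\ v) = gam [set: G]) ->
  (forall v, v \in core -> gam (core :\ v) = gam core) /\
  (forall f, opt core f -> f u = 0).
Proof.
move=> S; have [[n12 n13 n23] m1 m2 m3] := pendant_neq.
have [_ E1 E2 E3] := Hp; have [N1 N2 N3] := pend_notin.
have lo : gam core + 2 <= gam [set: G].
  by rewrite -{1}[core]setTI; apply: gam_core_ge.
(* If [g u = 2], then in G - v2 the vertex [v3] is dominated by [u] and [v1] takes 1. This costs
   [gam core + 1], below the bound [lo]. *)
have not2 g : opt core g -> g u <> 2.
  move=> [P wg] gu; pose k := upd (upd g [set v2; v3] 0) [set v1] 1.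
  have kC x : x \in core -> k x = g x.
    move=> /coreP[x1 x2 x3].
    by rewrite /k /upd !inE (negPf x1) (negPf x2) (negPf x3).
  have k1 : k v1 = 1 by rewrite /k /upd !inE eqxx.
  have k2 : k v2 = 0 by rewrite /k /upd !inE eqxx eq_sym (negPf n12).
  have k3 : k v3 = 0 by rewrite /k /upd !inE eqxx orbT eq_sym (negPf n13).
  have /gam_le : prd_on ([set: G] :\ v2) k.
    move=> x xA kx; have [Ex|Ex|Ex|xC] := mem_core x.
    - by move: kx; rewrite Ex k1.
    - by move: xA; rewrite Ex !inE eqxx.
    - exists u; rewrite Ex E3 eqxx orbT kC ?u_core // !inE eq_sym m2.
      split=> // w'; rewrite !inE E3 => /andP[/negPf-> _].
      by move=> /eqP.
    have [|w [wC xw gw Uw]] := P x xC; first by rewrite -kC.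
    have [_ nw _] := coreP wC.
    exists w; rewrite kC // !inE nw; split=> // w' _ xw'.
    have [w'C|[_ ->]] := core_nbr xC xw'; last by rewrite k3.
    by rewrite kC // => kw'; apply: Uw.
  have := wt_setD1 k (in_setT v2).
  rewrite (wt_core k (in_setT _) (in_setT _) (in_setT _)) setTI S k1 k2 k3.
  by rewrite (eq_in_wt kC) wg; clear -lo; lia.
(* Since [g u] is not 2, [g] extends to the path at cost 2 and becomes optimal on G, where the value
   1 is impossible. *)
have is0 g : opt core g -> g u = 0.
  move=> og; have := opt_le2 og u_core; have := not2 g og.
  have [P wg] := og.
  have [|||||h []] := @gam_core_le [set: G] g; rewrite ?in_setT ?setTI //.
    by move=> _; apply: not2.
  move=> Ph wh hC _; have := @stable_opt_neq1 _ h u S Ph; rewrite wh wg hC ?u_core //.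
  by clear -lo; lia.
split=> // v vC; apply/eqP; rewrite eqn_leq; apply/andP; split.
  have [g og] := ex_opt core; have [P wg] := og.
  have [|||||h []] := @gam_core_le [set: G] g; rewrite ?in_setT ?setTI //.
    by move=> _; apply: not2.
  move=> /gam_le + + _ _; have [nv1 nv2 nv3] := coreP vC.
  have := @gam_core_ge ([set: G] :\ v).
  rewrite !inE !(eq_sym _ v) nv1 nv2 nv3 S setIDAC setTI => /(_ isT isT isT).
  by rewrite wg; clear; lia.
(* Were [g] cheaper than [gam core], setting [v] to 1 would make it optimal on [core], hence 0 at
   [u]. So [v] is not [u], [g u = 0], and [g] extends to the path at cost 2, which is too cheap for
   G - v. *)
rewrite leqNgt; apply/negP=> lt; have [g [P wg]] := ex_opt (core :\ v).
have E := wt_upd1 g 1 vC; rewrite (wt_setD1 g vC) wg in E.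
have P1 := prd_on_upd1 P; have le1 := gam_le P1.
have : upd g [set v] 1 u = 0 by apply: is0; split=> //; clear -lt E le1; lia.
rewrite /upd inE; case: eqP => // _ gu.
have [nv1 nv2 nv3] := coreP vC.
have Ev : ([set: G] :\ v) :&: core = core :\ v by rewrite setIDAC setTI.
have [|||||h []] := @gam_core_le ([set: G] :\ v) g;
  rewrite ?Ev ?inE ?(eq_sym _ v) ?nv1 ?nv2 ?nv3 //; first by rewrite gu.
by move=> /gam_le; rewrite S wg; clear -lo lt; lia.
Qed.

(* In the second alternative u is dominated by v3 alone; raising u to 1 then
   gives a function that is not optimal on core. *)
Lemma core_low (A : {set G}) k :
  (forall f, opt core f -> f u = 0) -> prd_on A k -> A :&: core = core ->
  gam core <= wt core k /\ (k u = 2 -> gam core < wt core k) \/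
  [/\ v3 \in A, k v3 = 2 & gam core <= wt core k].
Proof.
move=> W Pk EA.
have W' f : prd_on core f -> f u <> 0 -> gam core < wt core f.
  move=> Pf fu; rewrite ltn_neqAle gam_le // andbT; apply/eqP=> E.
  by apply: fu; apply: W; split.
have [|[_ ku v3A kv3]] := prd_on_core Pk; rewrite EA => Pk'.
  by left; split=> [|ku]; [apply: gam_le | apply: W'; rewrite ?ku].
right; split=> //.
have /(W' _ Pk') : upd k [set u] 1 u <> 0 by rewrite /upd inE eqxx.
by have := wt_upd1 k 1 u_core; lia.
Qed.

(** This is the inductive step for Operation O1: both stability and the degree bound pass from
    [core] to G. *)
Lemma pendant_stable f :
  (forall v, v \in core -> gam (core :\ v) = gam core) ->
  (forall f, opt core f -> f u = 0) -> opt core f ->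
  (forall v, v \in core -> f v <> 0 -> #|nbr_in core v| <= f v) ->
  (forall v, gam ([set: G] :\ v) = gam [set: G]) /\
  (exists2 h, opt [set: G] h &
     forall v, h v <> 0 -> #|nbr_in [set: G] v| <= h v).
Proof.
move=> S W of_ deg; have [P wf] := of_; have fu := W f of_.
have [[n12 n13 n23] m1 m2 m3] := pendant_neq.
have [_ E1 E2 E3] := Hp; have [N1 N2 N3] := pend_notin.
have [|||||h [Ph wh hC [h1 h2 h3]]] := @gam_core_le [set: G] f;
  rewrite ?in_setT ?setTI ?fu //; rewrite setTI wf in wh.
have gT : gam [set: G] = gam core + 2.
  have := gam_le Ph; have := @gam_core_ge [set: G] (in_setT _) (in_setT _) (in_setT _).
  by rewrite setTI wh; clear; lia.
have oh : opt [set: G] h by split=> //; rewrite wh gT.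
(* On the path only [v2] is nonzero, with value 2 and two neighbours. In [core] only [u] gains a
   neighbour, and [h] vanishes there. *)
have dh v : h v <> 0 -> #|nbr_in [set: G] v| <= h v.
  have [->|->|->|vC] := mem_core v; rewrite ?h1 ?h2 ?h3 //.
    move=> _; apply: leq_trans (_ : #|[set v1; v3]| <= 2).
      by apply: subset_leq_card; apply/subsetP=> w; rewrite !inE E2.
    by rewrite cards2; case: (_ != _).
  rewrite hC // => fv; apply: leq_trans (deg v vC fv).
  apply: subset_leq_card; apply/subsetP=> w /setIdP[_ vw]; apply/setIdP.
  by have [|[Ev _]] := core_nbr vC vw; last by rewrite Ev fu in fv.
split; last by exists h.
move=> v; apply/eqP; rewrite eqn_leq; apply/andP; split.
  by case: oh => _ <-; apply: gam_del_le => //; apply: dh.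
(* When [v] lies on the path, the two surviving path vertices weigh at least 2, except possibly when
   [u] has value 2 and dominates [v3]; [core_low] then supplies the missing 1. *)
rewrite gT; have [->|->|->|vC] := mem_core v.
- have [k [Pk <-]] := ex_opt ([set: G] :\ v1).
  have wk := wt_setD1 k (in_setT v1).
  rewrite (wt_core k (in_setT _) (in_setT _) (in_setT _)) setTI in wk.
  have k2 : k v2 = 0 -> k v3 = 2.
    move/(Pk v2); rewrite !inE eq_sym n12 => /(_ isT)[w [+ + kw _]].
    by rewrite !inE E2 => /andP[/negPf-> _] /eqP <-.
  have k3 : k v3 = 0 -> k v2 = 2 \/ k u = 2.
    move/(Pk v3); rewrite !inE eq_sym n13 => /(_ isT)[w [_ + kw _]].
    by rewrite E3 => /orP[]/eqP<-; [left|right].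
  have [[lo lt]|[_ kv3 lo]] := core_low W Pk (setTD_core N1).
    by clear -wk k2 k3 lo lt; lia.
  by clear -wk k2 k3 kv3 lo; lia.
- have [k [Pk <-]] := ex_opt ([set: G] :\ v2).
  have wk := wt_setD1 k (in_setT v2).
  rewrite (wt_core k (in_setT _) (in_setT _) (in_setT _)) setTI in wk.
  have k1 : k v1 <> 0.
    move/(Pk v1); rewrite !inE n12 => /(_ isT)[w [+ + kw _]].
    by rewrite !inE E1 => /andP[/negPf->].
  have k3 : k v3 = 0 -> k u = 2.
    move/(Pk v3); rewrite !inE eq_sym n23 => /(_ isT)[w [+ + kw _]].
    by rewrite !inE E3 => /andP[/negPf-> _] /eqP <-.
  have [[lo lt]|[_ kv3 lo]] := core_low W Pk (setTD_core N2).
    by clear -wk k1 k3 lo lt; lia.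
  by clear -wk k1 k3 kv3 lo; lia.
- have [k [Pk <-]] := ex_opt ([set: G] :\ v3).
  have wk := wt_setD1 k (in_setT v3).
  rewrite (wt_core k (in_setT _) (in_setT _) (in_setT _)) setTI in wk.
  have k1 : k v1 = 0 -> k v2 = 2.
    move/(Pk v1); rewrite !inE n13 => /(_ isT)[w [_ + kw _]].
    by rewrite E1 => /eqP <-.
  have k2 : k v2 = 0 -> k v1 = 2.
    move/(Pk v2); rewrite !inE n23 => /(_ isT)[w [+ + kw _]].
    by rewrite !inE E2 orbC => /andP[/negPf-> _] /eqP <-.
  have [[lo lt]|[+ kv3 lo]] := core_low W Pk (setTD_core N3); last first.
    by rewrite !inE eqxx.
  by clear -wk k1 k2 lo; lia.
have [nv1 nv2 nv3] := coreP vC; rewrite -(S v vC).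
have := @gam_core_ge ([set: G] :\ v).
by rewrite !inE !(eq_sym _ v) nv1 nv2 nv3 setIDAC setTI => ->.
Qed.

End PendantPath.

(** * Members of the family are stable *)

(** The invariant of the construction. The second clause bounds the cost of deleting a vertex after
    the next path is attached. *)
Definition strongly_stable (G : sgraph) : Prop :=
  (forall v : G, gam ([set: G] :\ v) = gam [set: G]) /\
  exists2 h, opt [set: G] h &
    forall v, h v <> 0 -> #|nbr_in [set: G] v| <= h v.

Lemma prd_stableE (G : sgraph) :
  prd_stable G <-> forall v : G, gam ([set: G] :\ v) = gam [set: G].
Proof.
rewrite (stable_gam (embedding_id G)).
by split=> S v; [apply: S; rewrite in_setT | move=> _; apply: S].
Qed.

Lemma ord3P (i : 'I_3) : [\/ i = @Ordinal 3 0 isT, i = @Ordinal 3 1 isT | i = @Ordinal 3 2 isT].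
Proof.
case: i => [[|[|[|//]]] i].
- by constructor 1; apply: val_inj.
- by constructor 2; apply: val_inj.
by constructor 3; apply: val_inj.
Qed.

Lemma siso_add_path3 (G H : sgraph) (u : G) : siso H (add_path3 u) ->
  exists (h : G -> H) (v1 v2 v3 : H),
    embedding h (~: [set v1; v2; v3]) /\ pendant v1 v2 v3 (h u).
Proof.
move/siso_sym=> [k [l kl lk] kE]; have k_inj := can_inj kl.
exists (fun x => k (inl x)), (k (inr (@Ordinal 3 2 isT))), (k (inr (@Ordinal 3 1 isT))),
  (k (inr (@Ordinal 3 0 isT))); split.
  split=> [x y /k_inj[]//|x y|y]; first by rewrite kE.
  rewrite -(lk y) !inE !(inj_eq k_inj); split=> [|[x /k_inj->]] //.
  case: (l y) => [x|i]; first by exists x.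
  by have [->|->|->] := ord3P i; rewrite eqxx ?orbT.
split; first by rewrite /= !inE !(inj_eq k_inj).
all: move=> y; rewrite -(lk y) kE !(inj_eq k_inj); case: (l y) => [x|i] //=.
all: try by have [->|->|->] := ord3P i.
all: by rewrite andbC.
Qed.

Lemma embedding_opt (H G : sgraph) (h : H -> G) (A : {set G}) f :
  embedding h A -> opt A f <-> opt [set: H] (f \o h).
Proof.
move=> hA; rewrite /opt (prd_on_embedding hA) (wt_embedding hA).
by rewrite -(prd_number_gam hA) (prd_number_gam (embedding_id H)).
Qed.

Lemma embedding_nbr (H G : sgraph) (h : H -> G) (A : {set G}) x :
  embedding h A -> #|nbr_in A (h x)| = #|nbr_in [set: H] x|.
Proof.
move=> [h_inj hE memA]; rewrite -(card_imset _ h_inj); apply: eq_card => y.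
apply/setIdP/imsetP => [[/memA[z ->]]|[z /setIdP[_ xz] ->]].
  by rewrite hE => xz; exists z => //; rewrite inE in_setT.
by rewrite hE xz; split=> //; apply/memA; exists z.
Qed.

Lemma strongly_stable_operation1 (G H : sgraph) :
  operation1 G H -> strongly_stable G -> strongly_stable H.
Proof.
move=> [u u0 /siso_add_path3[h [v1 [v2 [v3 [hC Hp]]]]]] [S [f of_ deg]].
have [f' Ef] := extend_embedding hC f.
have of' : opt (~: [set v1; v2; v3]) f'.
  apply/(embedding_opt _ hC); split.
    by case: of_ => P _; apply: prd_on_eq P => x; rewrite /= Ef.
  by case: of_ => _ <-; apply: eq_wt => x; rewrite /= Ef.
apply: (pendant_stable Hp) of' _.
- by apply/(stable_gam hC)/prd_stableE.
- by move=> g; apply: (proj1 (always0P u hC) u0).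
move=> v vC; have [_ _ memC] := hC; move/memC: vC => [x ->].
by rewrite Ef (embedding_nbr _ hC); apply: deg.
Qed.

Definition path3 (G : sgraph) (a b c : G) : Prop :=
  [/\ uniq [:: a; b; c], forall x, x \in [:: a; b; c],
      forall x, (a -- x) = (x == b),
      forall x, (b -- x) = (x == a) || (x == c)
    & forall x, (c -- x) = (x == b)].

Lemma siso_path3 (G : sgraph) :
  siso G (path_graph 3) <-> exists a b c : G, path3 a b c.
Proof.
split=> [/siso_sym[k [l kl lk] kE]|[a [b [c [/= /and3P[+ + _] abc Ea Eb Ec]]]]].
{ have k_inj := can_inj kl.
  exists (k (@Ordinal 3 0 isT)), (k (@Ordinal 3 1 isT)), (k (@Ordinal 3 2 isT)).
  split=> [|x|x|x|x]; first by rewrite /= !inE !(inj_eq k_inj).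
  all: by rewrite -(lk x) ?inE ?kE !(inj_eq k_inj); have [->|->|->] := ord3P (l x). }
rewrite !inE negb_or => /andP[/negPf nab /negPf nac] /negPf nbc.
have nba : (b == a) = false by rewrite eq_sym.
have nca : (c == a) = false by rewrite eq_sym.
have ncb : (c == b) = false by rewrite eq_sym.
pose N := (nab, nac, nbc, nba, nca, ncb, eqxx, orbT).
pose k (i : 'I_3) := nth a [:: a; b; c] i.
apply: siso_sym; exists (k : path_graph 3 -> G).
  exists (fun x => if x == a then @Ordinal 3 0 isT else
                   if x == b then @Ordinal 3 1 isT else @Ordinal 3 2 isT).
    by move=> i; have [->|->|->] := ord3P i; rewrite /k /= !N.
  by move=> x; move: (abc x); rewrite !inE /k => /or3P[]/eqP->; rewrite !N.
by move=> i j; have [->|->|->] := ord3P i; have [->|->|->] := ord3P j;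
  rewrite /k /= ?Ea ?Eb ?Ec !N.
Qed.

Lemma strongly_stable_path3 (G : sgraph) :
  siso G (path_graph 3) -> strongly_stable G.
Proof.
move/siso_path3 => [a [b [c [/= /and3P[+ + _] abc Ea Eb Ec]]]].
rewrite !inE negb_or => /andP[nab nac] nbc.
have wE f : wt [set: G] f = f a + f b + f c.
  have -> : [set: G] = a |: (b |: [set c]).
    by apply/setP=> x; rewrite !inE -in_set1; move: (abc x); rewrite !inE => ->.
  rewrite /wt !big_setU1 ?inE ?negb_or ?nab ?nac // big_set1 /=; lia.
pose f x := if x == b then 2 else 0.
have Pf : prd_on [set: G] f.
  move=> x _ fx; exists b; rewrite /f eqxx in_setT; split=> //.
    move: (abc x) fx; rewrite !inE /f => /or3P[]/eqP->; rewrite ?eqxx //.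
      by rewrite Ea eqxx.
    by rewrite Ec eqxx.
  by move=> w' _ _; case: eqP.
have wf : wt [set: G] f = 2.
  by rewrite wE /f eqxx (negPf nab) eq_sym (negPf nbc).
have df v : f v <> 0 -> #|nbr_in [set: G] v| <= f v.
  rewrite /f; case: eqP => // -> _.
  apply: leq_trans (_ : #|[set a; c]| <= 2).
    by apply: subset_leq_card; apply/subsetP=> w; rewrite !inE Eb.
  by rewrite cards2; case: (_ != _).
have lo0 : 2 <= gam [set: G].
  have [k [Pk <-]] := ex_opt [set: G]; rewrite wE.
  have ka : k a = 0 -> k b = 2.
    by move/(Pk _ (in_setT _))=> [w [_]]; rewrite Ea => /eqP->.
  have kc : k c = 0 -> k b = 2.
    by move/(Pk _ (in_setT _))=> [w [_]]; rewrite Ec => /eqP->.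
  by lia.
have gT : gam [set: G] = 2 by have := gam_le Pf; lia.
split; last by exists f => //; split=> //; rewrite wf gT.
move=> v; apply/eqP; rewrite eqn_leq gT; apply/andP; split.
  by rewrite -wf; apply: gam_del_le => //; apply: df.
(* Without the centre both ends are isolated and positive. Without an end, the two remaining
   vertices are both positive or one has value 2. *)
have [k [Pk <-]] := ex_opt ([set: G] :\ v).
have := wt_setD1 k (in_setT v); rewrite wE.
have ka : a != v -> k a = 0 -> b != v /\ k b = 2.
  move=> nv /(Pk a); rewrite !inE nv => /(_ isT)[w [+ + kw _]].
  by rewrite Ea !inE andbT => + /eqP<-.
have kc : c != v -> k c = 0 -> b != v /\ k b = 2.
  move=> nv /(Pk c); rewrite !inE nv => /(_ isT)[w [+ + kw _]].
  by rewrite Ec !inE andbT => + /eqP<-.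
have kb : b != v -> k b = 0 -> a != v /\ k a = 2 \/ c != v /\ k c = 2.
  move=> nv /(Pk b); rewrite !inE nv => /(_ isT)[w [+ + kw _]].
  by rewrite Eb !inE andbT => + /orP[]/eqP<-; [left|right].
move: (abc v); rewrite !inE => /or3P[]/eqP Ev; subst v;
  rewrite ?nab ?nac ?nbc ?eqxx ?(eq_sym b a) ?(eq_sym c) ?nab ?nac ?nbc in ka kb kc *; lia.
Qed.

Lemma family_T_stable (T : sgraph) : family_T T -> prd_stable T.
Proof.
move=> [k [S [k_gt0 _ S1 Sk op]]].
have SS i : 1 <= i <= k -> strongly_stable (S i).
  elim: i => [//|[_ _|i IH lt_ik]]; first exact: strongly_stable_path3.
  apply: (strongly_stable_operation1 (op _ _)); first by lia.
  by apply: IH; lia.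
have [|st _] := SS k; first by rewrite k_gt0 leqnn.
have [h hk] := siso_embedding (siso_sym Sk).
by apply/(stable_gam hk) => v _; apply: st.
Qed.

(** * Depth in a tree *)

(** A walk from [y] to [z] avoiding [x], shortened to a path, would close to a cycle through [x] if
    [y] and [z] were distinct. *)
Lemma acyclic_nbr (G : sgraph) (x y z : G) : acyclic G ->
  x -- y -> x -- z ->
  connect (fun a b => [&& a -- b, a != x & b != x]) y z -> y = z.
Proof.
move=> acG xy xz /connectP[q qP Ez]; apply/eqP; apply/negPn/negP=> nyz.
case: (shortenP qP) Ez => p pP p_uniq _ Ez.
have nx : x \notin y :: p.
  rewrite inE negb_or; apply/andP; split.
    by apply/eqP=> E; rewrite E sg_irrefl in xy.
  elim: p y pP {xy nyz Ez p_uniq qP} => //= a p IH y /andP[/and3P[_ _ nax] /IH nx].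
  by rewrite inE negb_or eq_sym nax.
have pE : path (@sedge G) y p by apply: sub_path pP => a b /and3P[].
have : 0 < size p by case: (p) Ez nyz => //= ->; rewrite eqxx.
move=> p_gt0; have : cycle (@sedge G) [:: x, y & p].
  by rewrite /= rcons_path xy pE -Ez sg_sym xz.
by apply/negP; apply: acG; rewrite //= nx.
Qed.

Section Depth.
Variables (G : sgraph) (r : G).
Hypothesis tG : is_tree G.

(** [d] is the distance from [r], read off from breadth-first balls, and [p] is the parent map. *)
Lemma tree_depth : exists (d : G -> nat) (p : G -> G),
  [/\ d r = 0,
      forall x, x != r -> x -- p x /\ d x = (d (p x)).+1
    & forall x y, x -- y ->
        y = p x /\ d x = (d y).+1 \/ x = p y /\ d y = (d x).+1].
Proof.
have [[_ cG] acG] := tG.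
pose ball n := iter n (fun S => [set x | (x \in S) || [exists y in S, y -- x]])
  [set r].
have ballS n x :
  (x \in ball n.+1) = (x \in ball n) || [exists y in ball n, y -- x].
  by rewrite /= inE.
have ex_ball x : exists n, x \in ball n.
  have /connectP[p pP ->] := cG r x.
  have: exists n, r \in ball n by exists 0; rewrite /= set11.
  elim: p r pP => //= y p IH z /andP[zy /IH yp] [n zn]; apply: yp.
  exists n.+1; rewrite ballS; apply/orP; right.
  by apply/existsP; exists z; rewrite zn.
pose d x := ex_minn (ex_ball x).
have dP x n : x \in ball n -> d x <= n.
  by rewrite /d; case: ex_minnP => m _ min_m /min_m.
have d_ball x : x \in ball (d x) by rewrite /d; case: ex_minnP.
have dr : d r = 0 by apply/eqP; rewrite -leqn0; apply: dP; rewrite /= set11.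
have down x : x != r -> exists2 y, x -- y & d x = (d y).+1.
  move=> nxr; case Ed: (d x) (d_ball x) => [|n].
    by rewrite /= inE (negPf nxr).
  rewrite ballS => /orP[/dP|/existsP[y /andP[yn yx]]]; first by lia.
  exists y; first by rewrite sg_sym.
  have := dP _ _ yn; have : d x <= (d y).+1; last by lia.
  apply: dP; rewrite ballS; apply/orP; right.
  by apply/existsP; exists y; rewrite d_ball.
pose av x : rel G := fun a b => [&& a -- b, a != x & b != x].
(* Each downward step strictly lowers the depth, so the path from [y] to [r] never reaches [x]. *)
have to_root x y : y != x -> d y <= d x -> connect (av x) y r.
  elim/ltn_ind: (d y) {-2}y (erefl (d y)) => n IH {}y Ey nyx le_yx.
  have [-> //|nyr] := eqVneq y r; have [z yz Ez] := down y nyr.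
  have nzx : z != x by apply/eqP=> E; rewrite E in Ez; lia.
  apply: connect_trans (IH (d z) _ z erefl nzx _); [|lia|lia].
  by apply: connect1; rewrite /av yz nyx.
(* Two neighbours of [x] no deeper than [x] are joined through [r] outside [x]; acyclicity
   identifies them. This makes the parent unique and rules out edges within a level. *)
have uniq_low x y z : x -- y -> x -- z -> d y <= d x -> d z <= d x -> y = z.
  move=> xy xz dy dz; apply: (acyclic_nbr acG xy xz).
  have nx w : x -- w -> w != x.
    by move=> xw; apply/eqP=> E; rewrite E sg_irrefl in xw.
  apply: connect_trans (to_root _ _ (nx _ xy) dy) _.
  rewrite sym_connect_sym; first exact: to_root (nx _ xz) dz.
  by move=> a b; rewrite /av sg_sym [(b != x) && _]andbC.
pose p x := odflt x [pick y | (x -- y) && (d x == (d y).+1)].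
have pP x : x != r -> x -- p x /\ d x = (d (p x)).+1.
  move=> /down[y xy dy]; rewrite /p; case: pickP => [z /andP[-> /eqP]//|/(_ y)].
  by rewrite xy dy eqxx.
have up x y : x -- y -> d y <= d x -> y = p x /\ d x = (d y).+1.
  move=> xy le_yx; have [Ex|/pP[xp dp]] := eqVneq x r.
    move: le_yx; rewrite Ex dr leqn0 => /eqP d0; have := d_ball y.
    by rewrite d0 /= inE => /eqP Ey; rewrite Ex Ey sg_irrefl in xy.
  by rewrite (uniq_low x y (p x) xy xp le_yx) //; lia.
exists d, p; split=> // x y xy; have [/(up _ _ xy)|/ltnW/up] := leqP (d y) (d x).
  by left.
by rewrite sg_sym; right; auto.
Qed.
End Depth.

(** * Leaves and stars at the boundary of a stable tree *)

Definition leaf_at (G : sgraph) (x s : G) : Prop :=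
  forall y, (x -- y) = (y == s).

(** These vertices are leaves only under [brush], where [w] is the neighbour of [s] towards the rest
    of the graph. *)
Definition leaves (G : sgraph) (s w : G) : {set G} :=
  [set y | (s -- y) && (y != w)].

Definition brush (G : sgraph) (s w : G) : Prop :=
  s -- w /\ forall y, y \in leaves s w -> leaf_at y s.

(** A brush hung on [e] through the degree-two vertex [w]. A brush with a single leaf hung in this
    way is a pendant path instead. *)
Definition claw (G : sgraph) (e w s : G) : Prop :=
  [/\ brush s w, forall y, (w -- y) = (y == s) || (y == e), s != e
    & 1 < #|leaves s w|].

Section Raise.
Variables (G : sgraph) (A S : {set G}) (f : G -> nat).

(** Only zeros change, so no 2 appears or disappears and [prd_on] survives. *)
Definition raise : G -> nat := upd f [set x in S | f x == 0] 1.

Lemma raise_eq2 x : raise x = 2 <-> f x = 2.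
Proof. by rewrite /raise /upd in_set; case: ifP => // /andP[_ /eqP->]. Qed.

Lemma raise_eq0 x : raise x = 0 <-> x \notin S /\ f x = 0.
Proof.
rewrite /raise /upd in_set; case: (x \in S) => /=; last by split=> [->|[]].
by case: (f x =P 0) => [_|fx]; split=> // -[].
Qed.

Lemma prd_on_raise : prd_on A f -> prd_on A raise.
Proof.
move=> P x xA /raise_eq0[_ /(P x xA)[w [wA xw fw Uw]]].
exists w; split=> //; first exact/raise_eq2.
by move=> w' ? ? /raise_eq2; apply: Uw.
Qed.

Lemma wt_raise : S \subset A -> wt A raise = wt A f + #|[set x in S | f x == 0]|.
Proof.
move=> SA; have := @wt_upd _ A [set x in S | f x == 0] f 1.
have -> : wt [set x in S | f x == 0] f = 0.
  by apply: big1 => x /setIdP[_ /eqP].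
rewrite addn0 mul1n; apply; apply/subsetP=> x /setIdP[xS _].
exact: (subsetP SA).
Qed.
End Raise.

Section Brush.
Variables (G : sgraph) (s w : G).
Hypothesis Hb : brush s w.
Let L := leaves s w.

Lemma brush_neq : s != w.
Proof. by have [sw _] := Hb; apply/eqP=> E; rewrite E sg_irrefl in sw. Qed.

Lemma brush_notin : s \notin L /\ w \notin L.
Proof. by rewrite !inE sg_irrefl eqxx andbF. Qed.

Lemma brush_nbr x : s -- x -> x = w \/ x \in L.
Proof.
by move=> sx; rewrite inE sx; case: eqP => [|_]; [left | right].
Qed.

Lemma brush_nbrL x y : x -- y -> x != s -> y \notin L.
Proof.
move=> xy nxs; apply/negP=> /(proj2 Hb) yE.
by rewrite sg_sym yE (negPf nxs) in xy.
Qed.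

Lemma brush_nbrs x : x -- s -> x != w -> x \in L.
Proof. by rewrite sg_sym => /brush_nbr[-> /eqP|]. Qed.

Lemma brush_sub : L \subset [set: G] :\ s.
Proof.
by apply/subsetP=> x xL; rewrite !inE andbT; apply: contraTneq xL => ->;
   have [] := brush_notin.
Qed.

(** A leaf of value 0 can be dominated only by [s]. *)
Lemma leaves_gt0 (A : {set G}) g y : prd_on A g -> L \subset A ->
  (s \in A -> g s <> 2) -> y \in L -> 0 < g y.
Proof.
move=> P LA gs yL; rewrite lt0n; apply/eqP=> gy.
have [w' [w'A + gw' _]] := P y (subsetP LA y yL) gy.
by rewrite (proj2 Hb y yL) => /eqP E; apply: gs; rewrite -E.
Qed.

(* Puts 2 on s and 0 on its leaves; w must not then be dominated twice. *)
Lemma brush_ext g :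
  (forall x, x != s -> x \notin L -> g x = 0 ->
     (exists z, [/\ x != w, x -- z, z != s, g z = 2 & forall z', x -- z' ->
        z' != s -> g z' = 2 -> z' = z]) \/
     (x = w /\ forall z, w -- z -> z != s -> g z <> 2)) ->
  exists h, [/\ prd_on [set: G] h,
    wt [set: G] h + wt L g = wt ([set: G] :\ s) g + 2
    & forall x, x != s -> x \notin L -> h x = g x].
Proof.
move=> P; pose h := upd (upd g L 0) [set s] 2.
have hE x : x != s -> x \notin L -> h x = g x.
  by move=> /negPf xs /negPf xL; rewrite /h /upd in_set1 xs xL.
have hs : h s = 2 by rewrite /h /upd in_set1 eqxx.
have hL x : x \in L -> h x = 0.
  move=> xL; have [sL _] := brush_notin; rewrite /h /upd in_set1 xL.
  by case: eqP => // E; rewrite -E xL in sL.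
exists h; split=> //; last first.
  have -> : wt [set: G] h = 2 + wt ([set: G] :\ s) (upd g L 0).
    rewrite (wt_setD1 h (in_setT s)) hs; congr (_ + _); apply: eq_in_wt => x.
    by rewrite !inE andbT => /negPf xs; rewrite /h {1}/upd in_set1 xs.
  by have := wt_upd g 0 brush_sub; rewrite mul0n addn0 -/L; lia.
move=> x _ hx; have nxs : x != s by apply/eqP=> E; rewrite E hs in hx.
have [xL|xL] := boolP (x \in L).
  exists s; rewrite hs in_setT (proj2 Hb x xL) eqxx; split=> // z _ + _.
  by rewrite (proj2 Hb x xL) => /eqP.
have [|[z [nxw xz nzs gz Uz]]|[Ex Uz]] := P x nxs xL _; first by rewrite -hE.
  exists z; rewrite in_setT hE ?(brush_nbrL xz) //; split=> // z' _ xz'.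
  have nz's : z' != s.
    by apply/eqP=> E; rewrite E in xz'; rewrite (brush_nbrs xz' nxw) in xL.
  by rewrite hE ?(brush_nbrL xz') //; apply: Uz.
have [sw _] := Hb; exists s; rewrite hs in_setT Ex sg_sym; split=> // z _ wz.
rewrite -Ex in wz; have [//|nzs] := eqVneq z s.
by rewrite hE ?(brush_nbrL wz) // => /Uz; rewrite -Ex; case.
Qed.

(** Deleting [s] isolates its leaves, so each costs at least 1 in [g]; clearing them offsets the 2
    placed on [s]. Being nonzero, [w] cannot suffer from the additional 2 beside it. *)
Lemma brush_ext_pos g : prd_on ([set: G] :\ s) g -> g w <> 0 ->
  exists h, [/\ prd_on [set: G] h, wt [set: G] h + #|L| <= wt ([set: G] :\ s) g + 2
    & forall x, x != s -> x \notin L -> h x = g x].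
Proof.
move=> P gw; have [|h [Ph wh hE]] := @brush_ext g.
  move=> x nxs _ gx; left.
  have [|z [/setD1P[nzs _] xz gz Uz]] := P x _ gx; first by rewrite !inE nxs.
  exists z; split=> //; first by apply/eqP=> E; rewrite E in gx.
  by move=> z' xz' nz's; apply: Uz; rewrite // !inE nz's.
exists h; split=> //; rewrite -wh leq_add2l; apply: wt_ge_card => y.
by apply: leaves_gt0 P brush_sub _; rewrite !inE eqxx.
Qed.

End Brush.

(** * Forced values in stable graphs *)

Section Stable.
Variable G : sgraph.
Hypothesis S : forall v : G, gam ([set: G] :\ v) = gam [set: G].

Lemma opt_neq1 f x : opt [set: G] f -> f x <> 1.
Proof. by move=> [P wf]; apply: stable_opt_neq1 => //; rewrite wf. Qed.

(** The value 1 is excluded at [x]. If [f x = 2], deleting [x] and raising [s] to at least 1 would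
    save weight. *)
Lemma opt_leaf f x s : leaf_at x s -> opt [set: G] f -> f x = 0 /\ f s = 2.
Proof.
move=> xE of_; have [P wf] := of_.
have fx : f x = 0.
  have := opt_le2 of_ (in_setT x); have := @opt_neq1 _ x of_.
  case Ex: (f x) => [//|[//|[|//]]] _ _.
  have nsx : s != x.
    by have := xE s; rewrite eqxx; apply: contraTneq => ->; rewrite sg_irrefl.
  have /gam_le : prd_on ([set: G] :\ x) (raise [set s] f).
    move=> v /setD1P[nvx _] /raise_eq0[]; rewrite inE => nvs fv.
    have [w [_ vw fw Uw]] := P v (in_setT v) fv.
    exists w; split=> //; last by move=> w' _ vw' /raise_eq2; apply: Uw.
      rewrite !inE andbT; apply: contraTneq vw => ->.
      by rewrite sg_sym xE.
    exact/raise_eq2.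
  rewrite wt_raise ?sub1set ?inE ?nsx // S.
  have := wt_setD1 f (in_setT x); rewrite wf Ex.
  have : #|[set y in [set s] | f y == 0]| <= 1.
    by rewrite -(cards1 s); apply: subset_leq_card; apply/subsetP=> y /setIdP[].
  by lia.
split=> //; have [w [_ + fw _]] := P x (in_setT x) fx.
by rewrite xE => /eqP <-.
Qed.

Lemma opt_brush f s w : brush s w -> 0 < #|leaves s w| -> opt [set: G] f ->
  f s = 2 /\ f w = 0.
Proof.
move=> Hb /card_gt0P[x xL] of_; have [P wf] := of_.
have [sL wL] := brush_notin s w; have nsw := brush_neq Hb.
have [fx fs] := opt_leaf (proj2 Hb x xL) of_; split=> //.
have := opt_le2 of_ (in_setT w); have := @opt_neq1 _ w of_.
case Ew: (f w) => [//|[//|[|//]]] _ _.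
(* Assume [f w = 2]. Delete the leaf [x], give 1 to the other leaves and let [w] dominate [s]: the
   weight drops by 2 and grows by the number of leaves minus 1. Stability forces at least three
   leaves. *)
have L3 : 3 <= #|leaves s w|.
  pose k := upd (upd f (leaves s w) 1) [set s] 0.
  have kE v : v != s -> v \notin leaves s w -> k v = f v.
    by move=> /negPf vs /negPf vL; rewrite /k /upd in_set1 vs vL.
  have ks : k s = 0 by rewrite /k /upd in_set1 eqxx.
  have kL v : v \in leaves s w -> k v = 1.
    move=> vL; rewrite /k /upd in_set1 vL; case: eqP => // E.
    by rewrite E (negPf sL) in vL.
  have /gam_le : prd_on ([set: G] :\ x) k.
    move=> v /setD1P[nvx _] kv.
    have [Ev|nvs] := eqVneq v s.
      exists w; rewrite Ev kE ?(eq_sym w) // Ew; split=> //.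
      - by rewrite !inE andbT; apply: contraNneq wL => {1}->.
      - by case: Hb.
      by move=> z _ /(@brush_nbr _ s w z)[//|/kL->].
    have vL : v \notin leaves s w by apply: contra_eqN kv => /kL->.
    rewrite kE // in kv; have [z [_ vz fz Uz]] := P v (in_setT v) kv.
    have nvw : v != w by apply: contra_eqN kv => /eqP->; rewrite Ew.
    have nzs z' : v -- z' -> z' != s.
      move=> vz'; apply: contraNneq vL => E; rewrite E in vz'.
      by apply: brush_nbrs vz' nvw.
    exists z; rewrite kE ?nzs ?(brush_nbrL Hb vz) //; split=> //.
      rewrite !inE andbT; apply: contraNneq (brush_nbrL Hb vz nvs) => ->.
      exact: xL.
    by move=> z' _ vz'; rewrite kE ?nzs ?(brush_nbrL Hb vz') //; apply: Uz.
  rewrite S; have := wt_setD1 k (in_setT x); rewrite kL //.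
  have := wt_upd1 (upd f (leaves s w) 1) 0 (in_setT s).
  have -> : upd f (leaves s w) 1 s = 2 by rewrite /upd (negPf sL).
  have := wt_upd f 1 (subsetT (leaves s w)).
  have -> : wt (leaves s w) f = 0.
    by apply: big1 => y /(proj2 Hb)/opt_leaf-/(_ _ of_)[].
  by rewrite wf -/k; lia.
(* With three leaves, an optimal function on G - s with [w] raised to at least 1 extends over [s]
   within [gam]. There is no slack, so [w] was raised from 0 and has the forbidden value 1. *)
have [g [Pg wg]] := ex_opt ([set: G] :\ s).
have [||h [Ph wh hE]] := @brush_ext_pos _ s w Hb (raise [set w] g).
- exact: prd_on_raise.
- by move/raise_eq0; rewrite set11 => -[].
rewrite wt_raise ?sub1set ?inE 1?eq_sym ?nsw // wg S in wh.
have le1 : #|[set y in [set w] | g y == 0]| <= 1.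
  by rewrite -(cards1 w); apply: subset_leq_card; apply/subsetP=> y /setIdP[].
have lo := gam_le Ph.
have hw : h w = 1.
  rewrite hE 1?eq_sym // /raise /upd in_set set11 /=; case: eqP => // gw.
  suff E0 : #|[set y in [set w] | g y == 0]| = 0 by lia.
  apply/eqP; rewrite cards_eq0; apply/eqP/setP=> y; rewrite !inE.
  by case: eqP => // ->; apply/eqP.
by have := stable_opt_neq1 (x := w) S Ph _ hw; lia.
Qed.

End Stable.

(** * Claws below a vertex of value 2 *)

Section Claw.
Variable G : sgraph.

(** If [s] has value 2, then [w] is positive, since at 0 it would be dominated by both [s] and [e].
    Otherwise all leaves are positive, and either [s] is positive too or some neighbour of [s] has
    value 2. *)
Lemma claw_weight (A : {set G}) g e w s : claw e w s ->
  e \in A -> w \in A -> s \in A -> leaves s w \subset A -> prd_on A g ->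
  g e = 2 -> 3 <= g w + g s + wt (leaves s w) g.
Proof.
move=> [Hb wE nse L2] eA wA sA LA P ge.
have gL : g s <> 2 -> forall y, y \in leaves s w -> 0 < g y.
  by move=> gs y; apply: (leaves_gt0 Hb P LA) => _.
have [gs|/eqP gs] := eqVneq (g s) 2.
  suff : g w <> 0 by rewrite gs; clear; lia.
  move=> gw; have [z [_ _ _ Uz]] := P w wA gw.
  have := Uz s sA; rewrite wE eqxx => /(_ isT gs) Es.
  have := Uz e eA; rewrite wE eqxx orbT => /(_ isT ge) Ee.
  by rewrite Es Ee eqxx in nse.
have le_L := wt_ge_card (gL gs).
case gs0 : (g s) => [|n]; last by clear -le_L L2; lia.
have [z [zA + gz _]] := P s sA gs0; case/(brush_nbr w) => [Ez|zL].
  by rewrite -[in g w]Ez gz; clear -le_L L2; lia.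
rewrite (wt_setD1 g zL) gz; rewrite (cardsD1 z) zL in L2.
have : #|leaves s w :\ z| <= wt (leaves s w :\ z) g.
  by apply: wt_ge_card => y /setD1P[_ /(gL gs)].
by clear -L2; lia.
Qed.

(** The claw receives 1 on [w], 2 on [s] and 0 on the leaves, the total 3 of [claw_weight]. Its only
    outer neighbour is [e], which has value 2 and needs no domination. *)
Lemma claw_normalize (A : {set G}) g e w s : claw e w s ->
  e \in A -> w \in A -> s \in A -> leaves s w \subset A -> prd_on A g -> g e = 2 ->
  exists g', [/\ prd_on A g', wt A g' <= wt A g, g' w = 1
    & forall x, x \notin w |: (s |: leaves s w) -> g' x = g x].
Proof.
move=> [Hb wE nse L2] eA wA sA LA P ge.
have [sL wL] := brush_notin s w; have nsw := brush_neq Hb.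
set L := leaves s w in sL wL L2 LA *.
pose g' := upd (upd (upd g L 0) [set s] 2) [set w] 1.
have g'w : g' w = 1 by rewrite /g' /upd in_set1 eqxx.
have g's : g' s = 2 by rewrite /g' /upd !in_set1 eqxx (negPf nsw).
have g'E x : x \notin w |: (s |: L) -> g' x = g x.
  by rewrite !in_setU1 !negb_or /g' /upd !in_set1 => /and3P[/negPf-> /negPf-> /negPf->].
have out x y : x \notin w |: (s |: L) -> x -- y -> g x = 0 ->
    y \notin w |: (s |: L).
  rewrite !in_setU1 !negb_or => /and3P[xw xs xL] xy gx.
  rewrite (brush_nbrL Hb xy) // andbT; apply/andP; split; apply/eqP=> E;
    rewrite E sg_sym in xy.
    by move: xy; rewrite wE (negPf xs) => /eqP Ex; rewrite Ex ge in gx.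
  by have [Ex|] := brush_nbr w xy; [rewrite Ex eqxx in xw | apply/negP].
exists g'; split=> //.
  move=> x xA gx; have [xL|xL] := boolP (x \in L).
    exists s; rewrite (proj2 Hb x xL) eqxx; split=> // z _ + _.
    by rewrite (proj2 Hb x xL) => /eqP.
  have xO : x \notin w |: (s |: L).
    rewrite !in_setU1 !negb_or xL andbT; apply/andP; split; apply/eqP=> E.
      by rewrite E g'w in gx.
    by rewrite E g's in gx.
  rewrite g'E // in gx; have [z [zA xz gz Uz]] := P x xA gx.
  exists z; rewrite (g'E z (out x z xO xz gx)); split=> // z' z'A xz'.
  by rewrite (g'E z' (out x z' xO xz' gx)); apply: Uz.
have e1 : wt A g' + upd (upd g L 0) [set s] 2 w = wt A (upd (upd g L 0) [set s] 2) + 1.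
  exact: wt_upd1.
have e2 : wt A (upd (upd g L 0) [set s] 2) + upd g L 0 s = wt A (upd g L 0) + 2.
  exact: wt_upd1.
have e3 := wt_upd g 0 LA.
have E1 : upd (upd g L 0) [set s] 2 w = g w.
  by rewrite /upd in_set1 eq_sym (negPf nsw) (negPf wL).
have E2 : upd g L 0 s = g s by rewrite /upd (negPf sL).
rewrite E1 in e1; rewrite E2 in e2; rewrite mul0n in e3.
have := claw_weight (And4 Hb wE nse L2) eA wA sA LA P ge.
by rewrite -/L; clear -e1 e2 e3; lia.
Qed.

(** Normalizing one claw at [e] therefore leaves the top vertices of the other claws at [e]
    untouched. *)
Lemma claw_block (e w s x : G) : claw e w s -> x -- e -> x != w ->
  x \notin w |: (s |: leaves s w).
Proof.
move=> [Hb wE nse _] xe nxw; rewrite !in_setU1 !negb_or nxw /=.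
apply/andP; split.
  apply/eqP=> Ex; rewrite Ex in xe; have [Ee|eL] := brush_nbr w xe.
    by have := wE e; rewrite Ee sg_irrefl eqxx orbT.
  have := proj2 Hb e eL w; rewrite sg_sym wE eqxx orbT.
  by move/esym/eqP => Ew; have := brush_neq Hb; rewrite Ew eqxx.
by apply/negP=> /(proj2 Hb)/(_ e); rewrite xe eq_sym (negPf nse).
Qed.

(* Spending 1 at the top of each claw never costs more: below a vertex e of
   value 2, a claw weighs at least 3 anyway. *)
Lemma claws_normalize (A W : {set G}) e :
  (forall g, opt A g -> g e = 2) -> e \in A ->
  (forall w, w \in W -> exists s,
     [/\ claw e w s, w \in A, s \in A & leaves s w \subset A]) ->
  exists2 g, opt A g & forall w, w \in W -> g w = 1.
Proof.
move=> He eA HW; have [g0 og0] := ex_opt A.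
pose bad g := #|[set w in W | g w != 1]|.
elim/ltn_ind: (bad g0) {-2}g0 (erefl (bad g0)) og0 => n IH g En og; have [|] := boolP (bad g == 0); first move=> /eqP/cards0_eq W0.
  exists g => // w wW; have : w \notin [set w in W | g w != 1] by rewrite W0 inE.
  by rewrite in_set wW /= negbK => /eqP.
rewrite -lt0n => /card_gt0P[w /setIdP[wW gw]].
have [s [Hc wA sA LA]] := HW w wW; have [Pg wg] := og.
have [g' [Pg' wg' g'w g'E]] := claw_normalize Hc eA wA sA LA Pg (He g og).
have og' : opt A g'.
  by split=> //; apply/eqP; rewrite eqn_leq gam_le // -wg wg'.
apply: (IH _ _ g' erefl og'); rewrite -En; apply: proper_card.
apply/properP; split; last by exists w; rewrite !in_set wW ?g'w.
apply/subsetP=> x /setIdP[xW g'x]; rewrite in_set xW /= -g'E //.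
have [s' [[_ xE _ _] _ _ _]] := HW x xW.
apply: (claw_block Hc); first by rewrite xE eqxx orbT.
by apply: contraNneq g'x => ->; rewrite g'w.
Qed.

End Claw.

Section StableClaw.
Variable G : sgraph.
Hypothesis S : forall v : G, gam ([set: G] :\ v) = gam [set: G].

(** If [g w = 1], extending over [s] gives an optimal function on G with the value 1. If [g w = 2],
    lower [w] to 1 and raise [e] to at least 1, at no extra cost, to reach the same contradiction.
    So [w] is 0, and only [e] remains to dominate it. *)
Lemma claw_opt (e w s : G) g : claw e w s -> opt ([set: G] :\ s) g ->
  g w = 0 /\ g e = 2.
Proof.
move=> [Hb wE nse L2] og; have [P wg] := og; rewrite S in wg.
have nsw := brush_neq Hb; have [_ wL] := brush_notin s w.
have wA : w \in [set: G] :\ s by rewrite !inE eq_sym nsw.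
have eA : e \in [set: G] :\ s by rewrite !inE eq_sym nse.
have absurd1 g' : prd_on ([set: G] :\ s) g' -> g' w = 1 ->
    wt ([set: G] :\ s) g' <= gam [set: G] -> False.
  move=> Pg' g'w wg'; have [|h [Ph wh hE]] := brush_ext_pos Hb Pg'.
    by rewrite g'w.
  apply: (stable_opt_neq1 (x := w) S Ph); last by rewrite hE // eq_sym.
  by clear -wh L2 wg'; lia.
have := opt_le2 og wA; case gw : (g w) => [|[|[|//]]] _.
- have [z [/setD1P[nzs _] + gz _]] := P w wA gw.
  by rewrite wE (negPf nzs) /= => /eqP <-.
- by case: (absurd1 g); rewrite ?wg.
case: (absurd1 (upd (raise [set e] g) [set w] 1)).
- move=> x xA; rewrite /upd in_set1; case: eqP => // /eqP nxw.
  move/raise_eq0; rewrite in_set1 => -[nxe gx].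
  have [z [zA xz gz Uz]] := P x xA gx.
  have out y : x -- y -> (y == w) = false.
    move=> xy; apply/eqP=> Ey; move: xy; rewrite Ey sg_sym wE (negPf nxe) orbF.
    by move/eqP=> Ex; rewrite Ex !inE eqxx in xA.
  exists z; rewrite in_set1 out //; split=> //; first exact/raise_eq2.
  by move=> z' z'A xz'; rewrite in_set1 out // => /raise_eq2; apply: Uz.
- by rewrite /upd set11.
have := wt_upd1 (raise [set e] g) 1 wA.
rewrite wt_raise ?sub1set // wg.
have /raise_eq2-> : g w = 2 by [].
have : #|[set x in [set e] | g x == 0]| <= 1.
  by rewrite -(cards1 e); apply: subset_leq_card; apply/subsetP=> y /setIdP[].
by clear; lia.
Qed.

(* The vertex o plays the parent of e, about which nothing is known. *)
Lemma no_claw (v2 v3 e o : G) : claw e v3 v2 ->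
  (forall w, e -- w -> w != v3 -> w != o ->
     (exists s, claw e w s) \/ brush w e /\ 0 < #|leaves w e|) -> False.
Proof.
move=> Hc He; have [Hb v3E nv2e L2] := Hc.
have nv23 := brush_neq Hb; have [v2L v3L] := brush_notin v2 v3.
set A := [set: G] :\ v2.
have inA x : (x \in A) = (x != v2) by rewrite !inE andbT.
have ev3 : e -- v3 by rewrite sg_sym v3E eqxx orbT.
have eL : e \notin leaves v2 v3 by apply: (brush_nbrL Hb (x := v3)); rewrite 1?sg_sym // eq_sym.
have nbr_e x : e -- x -> x != v2 /\ x \notin leaves v2 v3.
  move=> ex; have [->|nx] := eqVneq x v3; first by rewrite eq_sym.
  have := claw_block Hc (_ : x -- e) nx; rewrite sg_sym => /(_ ex).
  by rewrite !in_setU1 !negb_or => /and3P[].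
pose brushy w := brush w e /\ 0 < #|leaves w e|.
(* In an optimal function on G, the centre of such a brush has value 2 while [e] has value 0 and is
   dominated exactly once. *)
have uniq_brush w w' : e -- w -> e -- w' -> brushy w -> brushy w' -> w = w'.
  move=> ew ew' [Bw Lw] [Bw' Lw']; have [f of_] := ex_opt [set: G].
  have [fw fe] := opt_brush S Bw Lw of_; have [fw' _] := opt_brush S Bw' Lw' of_.
  have [z [_ _ _ Uz]] := proj1 of_ e (in_setT e) fe.
  by rewrite (Uz w) // (Uz w').
have [f of_] := ex_opt [set: G].
(* An optimal [f] is 0 at the top of a claw and 2 at the centre of a brush, so testing [f w == 0]
   separates the two alternatives. *)
pose W := [set w | [&& e -- w, w != v3, w != o & f w == 0]].
have clawW w : w \in W -> exists s, claw e w s.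
  rewrite inE => /and4P[ew nw3 nwo fw]; have [//|[Bw Lw]] := He w ew nw3 nwo.
  by have [f2 _] := opt_brush S Bw Lw of_; rewrite f2 in fw.
have brushyW w : e -- w -> w != v3 -> w != o -> w \notin W -> brushy w.
  move=> ew nw3 nwo; rewrite inE ew nw3 nwo /=; have [[s Hs]|//] := He w ew nw3 nwo.
  have [Bs _ _ Ls] := Hs; have [_ ->] := opt_brush S Bs (ltnW Ls) of_.
  by rewrite eqxx.
have [|||g og gW] := @claws_normalize _ A W e.
- by move=> g /(claw_opt Hc)[].
- by rewrite inA eq_sym.
- move=> w wW; have [s Hs] := clawW w wW; exists s.
  move: wW; rewrite inE => /and4P[ew nw3 nwo _].
  have [Bs wE nse Ls] := Hs; have [nw2 w2L] := nbr_e w ew.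
  rewrite !inA nw2; split=> //.
    apply: contraNneq w2L => Es; have [sw _] := Bs; rewrite Es in sw.
    by have [Ew|//] := brush_nbr v3 sw; rewrite Ew eqxx in nw3.
  apply/subsetP=> y yL; rewrite inA; apply/eqP=> Ey; rewrite Ey in yL.
  have := proj2 Bs _ yL v3; have [-> _] := Hb => /esym/eqP Es.
  have := claw_block Hs (_ : v3 -- e); rewrite sg_sym eq_sym => /(_ ev3 nw3).
  by rewrite Es !in_setU1 eqxx orbT.
have [g3 ge] := claw_opt Hc og; have [Pg wg] := og; rewrite S in wg.
have gL y : y \in leaves v2 v3 -> 0 < g y.
  by apply: (leaves_gt0 Hb Pg (brush_sub v2 v3)); rewrite inA eqxx.
(* Each rearrangement ends here: the leaves of [v2] pay for its value 2, and the extension is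
   optimal on G with the value 1 at [x]. *)
have finish g' x : wt A g' <= gam [set: G] ->
    (forall y, y \in leaves v2 v3 -> 0 < g' y) -> x \in A ->
    x \notin leaves v2 v3 -> g' x = 1 ->
    (forall y, y != v2 -> y \notin leaves v2 v3 -> g' y = 0 ->
     (exists z, [/\ y != v3, y -- z, z != v2, g' z = 2 & forall z', y -- z' ->
        z' != v2 -> g' z' = 2 -> z' = z]) \/
     (y = v3 /\ forall z, v3 -- z -> z != v2 -> g' z <> 2)) -> False.
  move=> wg' g'L xA xL g'x /(brush_ext Hb)[h [Ph wh hE]].
  apply: (stable_opt_neq1 (x := x) S Ph); last by rewrite hE // -inA.
  by have := wt_ge_card g'L; rewrite -/A in wh; clear -wh L2 wg'; lia.
pose M := [set x | [&& e -- x, x != v3 & g x == 0]].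
have eA : e \in A by rewrite inA eq_sym.
have nML x : x \in M -> x \notin leaves v2 v3.
  by rewrite inE => /and3P[/nbr_e[]].
(* M collects the vertices other than v3 that only e = 2 can dominate.  If
   there is at most one, lower e to 1 and raise it to 1.  Otherwise M = {z, o}
   with z carrying leaves: move the 2 from e to z, and set o to 1. *)
have [M1|/card_gt1P[a [b [aM bM nab]]]] := leqP #|M| 1.
  have MA : M \subset A.
    by apply/subsetP=> x; rewrite inE inA => /and3P[/nbr_e[]].
  have eM : e \notin M by rewrite inE sg_irrefl.
  pose g' := upd (upd g M 1) [set e] 1.
  have g'E x : x != e -> x \notin M -> g' x = g x.
    by move=> /negPf nxe /negPf xM; rewrite /g' /upd in_set1 nxe xM.
  have g'e : g' e = 1 by rewrite /g' /upd in_set1 eqxx.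
  have g'M x : x \in M -> g' x = 1.
    by move=> xM; rewrite /g' /upd in_set1 xM; case: eqP.
  have g'2 x : g' x = 2 -> [/\ x != e, x \notin M & g x = 2].
    have [->|nxe] := eqVneq x e; first by rewrite g'e.
    have [/g'M->//|xM] := boolP (x \in M).
    by rewrite g'E.
  apply: (finish g' e) => //.
  - have := wt_upd1 (upd g M 1) 1 eA; have := wt_upd g 1 MA.
    have -> : upd g M 1 e = 2 by rewrite /upd (negPf eM).
    have -> : wt M g = 0 by apply: big1 => x; rewrite inE => /and3P[_ _ /eqP].
    by rewrite wg -/g'; clear -M1; lia.
  - move=> y yL; rewrite g'E ?gL //; first by apply: contraTneq yL => ->.
    by apply: contraL yL => /nML.
  - move=> x nx2 xL g'x.
    have nxe : x != e by apply/eqP=> E; rewrite E g'e in g'x.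
    have xM : x \notin M by apply/negP=> E; rewrite g'M in g'x.
    have [Ex|nx3] := eqVneq x v3.
      right; split=> // z; rewrite v3E => /orP[/eqP-> /eqP//|/eqP-> _].
      by rewrite g'e.
    rewrite g'E // in g'x; have xe : ~~ (x -- e).
      by apply: contra xM; rewrite inE nx3 g'x eqxx /= andbT sg_sym.
    have [|z [zA xz gz Uz]] := Pg x _ g'x; first by rewrite inA.
    left; exists z; split=> //; first by rewrite -inA.
      rewrite g'E //; first by apply: contraNneq xe => <-.
      by rewrite inE gz andbF andbF.
    by move=> z' xz' nz'2 /g'2[_ _]; apply: Uz; rewrite ?inA.
have Mbrushy x : x \in M -> x != o -> brushy x.
  rewrite inE => /and3P[ex nx3 gx] nxo; apply: brushyW => //.
  by apply/negP=> /gW E; rewrite E in gx.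
(* Every member of [M] other than [o] is the centre of a brush, and there is at most one such
   centre. *)
have [z [zM nzo oM]] : exists z, [/\ z \in M, z != o & o \in M].
  have [Ea|nao] := eqVneq a o; first by exists b; rewrite -Ea eq_sym.
  have [Eb|nbo] := eqVneq b o; first by exists a; rewrite -Eb.
  move: (aM) (bM) nab; rewrite !inE => /and3P[ea _ _] /and3P[eb _ _].
  by rewrite (uniq_brush a b) ?eqxx //; apply: Mbrushy.
have [Bz Jz] := Mbrushy z zM nzo.
move: zM oM; rewrite !inE => /and3P[ez nz3 /eqP gz] /and3P[eo no3 /eqP go].
pose J := leaves z e.
have [nz2 zL] := nbr_e z ez; have [no2 oL] := nbr_e o eo.
have nze : z != e by apply: contraTneq ez => ->; rewrite sg_irrefl.
have noe : o != e by apply: contraTneq eo => ->; rewrite sg_irrefl.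
have [zJ eJ] := brush_notin z e; rewrite -/J in zJ eJ.
have nbr_eJ x : e -- x -> x \notin J.
  by move=> ex; apply: (brush_nbrL Bz ex); rewrite eq_sym.
have oJ := nbr_eJ o eo.
have JA : J \subset A.
  apply/subsetP=> y yJ; rewrite inA; apply/eqP=> Ey; rewrite Ey in yJ.
  have := proj2 Bz _ yJ v3; have [-> _] := Hb => /esym/eqP E3.
  by rewrite E3 eqxx in nz3.
have gJ y : y \in J -> 0 < g y.
  by apply: (leaves_gt0 Bz Pg JA); rewrite gz.
(* Since [g z = 0], the leaves of [z] had positive values; clearing them pays for the 1 at [o]. *)
pose g' := upd (upd (upd (upd g J 0) [set e] 0) [set o] 1) [set z] 2.
have g'z : g' z = 2 by rewrite /g' /upd !in_set1 eqxx.
have g'o : g' o = 1 by rewrite /g' /upd !in_set1 eqxx eq_sym (negPf nzo).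
have g'e : g' e = 0.
  by rewrite /g' /upd !in_set1 eqxx !(eq_sym e) (negPf nze) (negPf noe).
have g'J x : x \in J -> g' x = 0.
  move=> xJ; rewrite /g' /upd !in_set1 xJ.
  case: eqP => [E|_]; first by rewrite E (negPf zJ) in xJ.
  by case: eqP => [E|_]; [rewrite E (negPf oJ) in xJ | case: ifP].
have g'E x : [&& x != z, x != o, x != e & x \notin J] -> g' x = g x.
  by rewrite /g' /upd !in_set1 => /and4P[/negPf-> /negPf-> /negPf-> /negPf->].
have g'2 x : g' x = 2 -> x = z \/ g x = 2.
  have [->|nxz] := eqVneq x z; first by left.
  have [->|nxo] := eqVneq x o; first by rewrite g'o.
  have [->|nxe] := eqVneq x e; first by rewrite g'e.
  have [/g'J->//|xJ] := boolP (x \in J).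
  by rewrite g'E ?nxz ?nxo ?nxe //; right.
have zE x : e -- x -> x != o -> x != v3 -> g x <> 1 -> x = z.
  move=> ex nxo nx3 gx; apply: uniq_brush => //; apply: brushyW => //.
  by apply/negP=> /gW.
apply: (finish g' o) => //.
- have := wt_upd g 0 JA; have := wt_upd1 (upd g J 0) 0 eA.
  have oA : o \in A by rewrite inA.
  have zA : z \in A by rewrite inA.
  have := wt_upd1 (upd (upd g J 0) [set e] 0) 1 oA.
  have := wt_upd1 (upd (upd (upd g J 0) [set e] 0) [set o] 1) 2 zA.
  have -> : upd (upd (upd g J 0) [set e] 0) [set o] 1 z = 0.
    by rewrite /upd !in_set1 (negPf nzo) (negPf nze) (negPf zJ).
  have -> : upd (upd g J 0) [set e] 0 o = 0.
    by rewrite /upd !in_set1 (negPf noe) (negPf oJ).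
  have -> : upd g J 0 e = 2 by rewrite /upd (negPf eJ).
  have := wt_ge_card gJ; rewrite -/g' wg -/J in Jz *.
  by clear -Jz; lia.
- move=> y yL; rewrite g'E ?gL //; apply/and4P; split.
  + by apply: contraTneq yL => ->.
  + by apply: contraTneq yL => ->.
  + by apply: contraTneq yL => ->.
  apply/negP=> /(proj2 Bz)/(_ v2); rewrite (proj2 Hb y yL) eqxx.
  by rewrite eq_sym (negPf nz2).
- by rewrite inA.
move=> y ny2 yL g'y; have [->|ny3] := eqVneq y v3.
  right; split=> // x; rewrite v3E => /orP[/eqP-> /eqP//|/eqP-> _].
  by rewrite g'e.
left; have [->|nye] := eqVneq y e.
  exists z; split=> // x ex _ /g'2[//|gx].
  by apply: zE; rewrite ?gx //; apply/eqP=> E; move: gx; rewrite E ?go ?g3.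
have [yJ|yJ] := boolP (y \in J).
  exists z; rewrite (proj2 Bz y yJ) eqxx; split=> // x + _ _.
  by rewrite (proj2 Bz y yJ) => /eqP.
have nyz : y != z by apply/eqP=> E; rewrite E g'z in g'y.
have nyo : y != o by apply/eqP=> E; rewrite E g'o in g'y.
rewrite g'E ?nyz ?nyo ?nye // in g'y.
have ye : ~~ (y -- e).
  by apply: contra nyz; rewrite sg_sym => ey; apply/eqP/zE; rewrite ?g'y.
have [|x [xA yx gx Ux]] := Pg y _ g'y; first by rewrite inA.
exists x; split=> //; first by rewrite -inA.
  rewrite g'E //; apply/and4P; split.
  - by apply/eqP=> E; rewrite E gz in gx.
  - by apply/eqP=> E; rewrite E go in gx.
  - by apply: contraNneq ye => <-.
  exact: (brush_nbrL Bz yx).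
move=> x' yx' nx'2 /g'2[Ex|]; last by apply: Ux; rewrite // inA.
move: yx'; rewrite Ex sg_sym => /(brush_nbr e)[E|]; last by rewrite -/J (negPf yJ).
by rewrite E eqxx in nye.
Qed.

End StableClaw.

(** * Finding a pendant path in a stable tree *)

Section Leaf.
Variable G : sgraph.
Hypothesis tG : is_tree G.

(** A vertex of maximal depth has only its parent as a neighbour. *)
Lemma ex_leaf : 1 < #|G| -> exists r c : G, leaf_at r c.
Proof.
move=> G_gt1; have [[/card_gt0P[r0 _] _] _] := tG.
have [d [p [dr pP dE]]] := tree_depth r0 tG.
have [r _ dmax] := @arg_maxnP G r0 xpredT d isT.
exists r, (p r) => y; apply/idP/eqP => [ry|->].
  have [[]//|[_ dy]] := dE _ _ ry; have := dmax y isT; rewrite /= dy.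
  by rewrite ltnn.
have [Er|/pP[]//] := eqVneq r r0; exfalso.
have : #|G| <= #|[set r0]|; last by rewrite cards1 leqNgt G_gt1.
apply: subset_leq_card; apply/subsetP=> x _; rewrite in_set1.
apply/negPn/negP=> /pP[_ dx]; have := dmax x isT.
by rewrite /= dx Er dr.
Qed.
End Leaf.

(** Deleting the centre isolates all other vertices, which then weigh at least their number, while 2
    on the centre suffices for the whole star. *)
Lemma stable_star (G : sgraph) (c : G) :
  (forall v : G, gam ([set: G] :\ v) = gam [set: G]) ->
  (forall x, x != c -> leaf_at x c) -> #|G| <= 3.
Proof.
move=> S star; have [g [P wg]] := ex_opt ([set: G] :\ c); rewrite S in wg.
have : #|[set: G] :\ c| <= wt ([set: G] :\ c) g.
  apply: wt_ge_card => x xA; have [nxc _] := setD1P xA.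
  rewrite lt0n; apply/eqP=> /(P x xA)[w [/setD1P[nwc _] + _ _]].
  by rewrite star // (negPf nwc).
have /gam_le : prd_on [set: G] (upd (fun=> 0) [set c] 2).
  move=> x _; rewrite /upd in_set1; case: eqP => // /eqP nxc _.
  exists c; rewrite set11 star //; split=> // w' _.
  by rewrite star // => /eqP.
have := @wt_upd1 _ [set: G] c (fun=> 0) 2 (in_setT c).
have -> : wt [set: G] (fun=> 0) = 0 by apply: big1.
have := cardsD1 c [set: G]; rewrite cardsT in_setT wg.
by clear; lia.
Qed.

Lemma brush_pendant (G : sgraph) (s w e : G) : brush s w ->
  (forall y, (w -- y) = (y == s) || (y == e)) -> s != e ->
  #|leaves s w| = 1 -> exists x, pendant x s w e.
Proof.
move=> Hb wE nse /eqP/cards1P[x Lx]; have [_ wL] := brush_notin s w.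
have xL : x \in leaves s w by rewrite Lx set11.
have sw : s -- w by case: Hb.
have sx : s -- x by move: xL; rewrite inE => /andP[].
have nsw := brush_neq Hb; exists x; split.
- rewrite /= !inE !negb_or nsw nse /= andbT -!andbA; apply/and4P; split.
  + by apply: contraTneq sx => ->; rewrite sg_irrefl.
  + by apply: contraTneq xL => ->.
  + apply/eqP=> E; have := proj2 Hb x xL w.
    by rewrite E sg_sym wE eqxx orbT eq_sym (negPf nsw).
  by apply/eqP=> E; have := wE e; rewrite -E sg_irrefl eqxx orbT.
- exact: proj2 Hb x xL.
- move=> y; rewrite -in_set1 -Lx; have [->|nyw] := eqVneq y w.
    by rewrite orbT sw.
  by rewrite orbF inE nyw andbT.
exact: wE.
Qed.

Lemma stable_tree_pendant (G : sgraph) : is_tree G -> 2 < #|G| ->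
  (forall v : G, gam ([set: G] :\ v) = gam [set: G]) ->
  (exists a b c : G, path3 a b c) \/
  exists v1 v2 v3 u : G, pendant v1 v2 v3 u.
Proof.
move=> tG G_gt2 S; have [r [c rE]] := ex_leaf tG (ltnW G_gt2).
have [d [p [dr pP dE]]] := tree_depth r tG.
have [v1 _ dmax] := @arg_maxnP G r xpredT d isT.
have {}dmax x : d x <= d v1 by apply: dmax.
have d0 x : d x = 0 -> x = r.
  by move=> dx; apply/eqP/negPn/negP => /pP[_]; rewrite dx.
have nr x n : d x = n.+1 -> x != r by move=> dx; apply/eqP=> E; rewrite E dr in dx.
have child x y : x -- y -> y != p x -> p y = x /\ d y = (d x).+1.
  by move=> xy nyp; have [[E _]|[]//] := dE _ _ xy; rewrite E eqxx in nyp.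
have deep x : x != r -> d x = d v1 -> leaf_at x (p x).
  move=> nxr dx y; apply/idP/eqP => [xy|->]; last by case: (pP _ nxr).
  have [//|nyp] := eqVneq y (p x); have [_ dy] := child _ _ xy nyp.
  by have := dmax y; rewrite dy dx ltnn.
have [f of_] := ex_opt [set: G]; have [Pf _] := of_.
(* At depth at most 1 there would be only the leaf [r] and its neighbour [c]. *)
have v1_gt1 : 1 < d v1.
  rewrite ltnNge; apply/negP=> le1; have : #|G| <= #|[set r; c]|.
    apply: subset_leq_card; apply/subsetP=> x _; rewrite !inE.
    have [//|nxr] := eqVneq x r; have [xp dx] := pP x nxr.
    have := leq_trans (dmax x) le1; rewrite dx ltnS leqn0 => /eqP/d0 Ep.
    by rewrite -rE sg_sym -Ep.
  by rewrite cards2; case: (r != c); clear -G_gt2; lia.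
have [D Dv1] : exists D, d v1 = D.+2.
  by case: (d v1) v1_gt1 => [|[|D]] // _; exists D.
(* The children of a vertex one level above the bottom have maximal depth, so they are leaves. *)
have brushD s : d s = D.+1 -> brush s (p s).
  move=> ds; have nsr := nr _ _ ds; split; first by case: (pP s nsr).
  move=> y; rewrite inE => /andP[sy nyp]; have [Ep dy] := child _ _ sy nyp.
  by rewrite -Ep; apply: deep; [apply: nr dy | rewrite dy ds Dv1].
have nv1r := nr _ _ Dv1; have [v1p] := pP _ nv1r; rewrite Dv1 => -[dv2].
move Ev2: (p v1) v1p dv2 => v2 v12 /esym dv2.
have nv2r := nr _ _ dv2; have [v2p] := pP _ nv2r; rewrite dv2 => -[/esym dv3].
have Hb := brushD v2 dv2; move Ev3: (p v2) v2p dv3 Hb => v3 v23 dv3 Hb.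
have v1L : v1 \in leaves v2 v3.
  rewrite inE sg_sym v12; apply/eqP=> E; move: Dv1; rewrite E dv3.
  by clear; lia.
(* If [D] is 0, then [v3] is the root. Being a leaf, the root has [v2] as its only neighbour, so the
   tree is a star around [v2], and stability leaves three vertices. *)
have [D0|D_gt0] := posnP D.
  left; have Er : v3 = r by apply: d0; rewrite dv3.
  have Ec : c = v2 by apply/esym/eqP; rewrite -rE sg_sym -Er.
  have d1 x : d x = 1 -> x = v2.
    move=> dx; have [xp] := pP x (nr _ _ dx); rewrite dx => -[/esym/d0 E].
    by apply/eqP; rewrite -Ec -rE sg_sym -E.
  have star x : x != v2 -> leaf_at x v2.
    move=> nx2; have [->|nxr] := eqVneq x r; first by rewrite -Ec.
    have [xp dx] := pP x nxr; case Ed: (d (p x)) => [|n].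
      by rewrite Ed in dx; rewrite (d1 x dx) eqxx in nx2.
    have dx2 : d x = d v1.
      by have := dmax x; rewrite dx Ed Dv1 D0; clear; lia.
    by rewrite -(d1 (p x)); [apply: deep | move: dx; rewrite dx2 Dv1 D0 => -[]].
  have n12 : v1 != v2 by apply: contraTneq v12 => ->; rewrite sg_irrefl.
  have n1r : v1 != r by [].
  have all3 x : [|| x == v1, x == v2 | x == r].
    have : [set v1; v2; r] == [set: G].
      rewrite eqEcard subsetT cardsT; apply: leq_trans (stable_star S star) _.
      by rewrite -setUA cardsU1 cards2 !inE negb_or n12 n1r nv2r.
    by move/eqP/setP/(_ x); rewrite !inE -orbA.
  exists v1, v2, r; split=> [|x|x|x|x].
  - by rewrite /= !inE negb_or n12 n1r nv2r.
  - by rewrite !inE.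
  - exact: star.
  - case/or3P: (all3 x) => /eqP->; first by rewrite sg_sym v12 eqxx.
      by rewrite sg_irrefl eq_sym (negPf n12) (negPf nv2r).
    by rewrite -Er v23 eqxx orbT.
  by rewrite -Ec; apply: rE.
right; have nv3r : v3 != r by apply/eqP=> E; rewrite -dv3 E dr in D_gt0.
(* By [opt_brush], [f w = 0]. A second child [y] of [w] with leaves would be a second neighbour of
   value 2, and a childless one would force [f w = 2]. Hence [w] has degree two. *)
have tops s w : p s = w -> d s = D.+1 -> w != r -> 0 < #|leaves s w| ->
    [/\ brush s w, forall y, (w -- y) = (y == s) || (y == p w) & s != p w].
  move=> Ep ds nwr Ls; have nsr := nr _ _ ds; have [sw dsw] := pP s nsr.
  have Bs := brushD s ds; rewrite Ep in Bs sw dsw.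
  have [wp dw] := pP w nwr; have [fs fw] := opt_brush S Bs Ls of_.
  split=> // [y|]; last first.
    by apply/eqP=> E; move: dsw; rewrite dw -E; clear; lia.
  apply/idP/orP => [wy|[]/eqP->//]; last by rewrite sg_sym.
  have [|nyp] := eqVneq y (p w); [by right | left].
  have [Epy dy] := child _ _ wy nyp.
  have [z [_ _ _ Uz]] := Pf w (in_setT w) fw.
  rewrite (Uz s) ?in_setT ?(sg_sym w) //; apply/eqP; apply: Uz => //.
  have By := brushD y; rewrite dy -dsw ds Epy in By; have {}By := By erefl.
  have [L0|] := posnP #|leaves y w|; last by move=> Ly; have [] := opt_brush S By Ly of_.
  suff yE : leaf_at y w by have [_] := opt_leaf S yE of_; rewrite fw.
  move=> x; apply/idP/eqP => [yx|->]; last by case: By.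
  have [//|] := brush_nbr w yx; rewrite (cards0_eq L0) inE.
  by [].
have L2 : 0 < #|leaves v2 v3| by apply/card_gt0P; exists v1.
have [_ v3E nv2e] := tops v2 v3 Ev3 dv2 nv3r L2.
set e := p v3 in v3E nv2e.
have [ev3 dve] := pP v3 nv3r; rewrite -/e dv3 sg_sym in ev3 dve.
have [L1|nL1] := eqVneq #|leaves v2 v3| 1.
  by have [x Hx] := brush_pendant Hb v3E nv2e L1; exists x, v2, v3, e.
have Hc : claw e v3 v2 by split=> //; rewrite ltn_neqAle eq_sym nL1.
(* A brush with a single leaf below another child of [e] also yields a pendant path. Once none
   exists, every brush with leaves at that level is part of a claw. *)
have [/existsP[w /existsP[s /and5P[ew nwp ws nse /eqP L1]]]|N] :=
  boolP [exists w, exists s, [&& e -- w, w != p e, w -- s, s != e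
                               & #|leaves s w| == 1]].
  have [Epw dw] := child _ _ ew nwp.
  have [|Eps ds] := child _ _ ws; first by rewrite Epw.
  have [|||Bs wE _] := tops s w Eps; rewrite ?L1 //.
  - by rewrite ds dw -dve.
  - exact: nr dw.
  rewrite Epw in wE; have [x Hx] := brush_pendant Bs wE nse L1.
  by exists x, s, w, e.
exfalso; apply: (no_claw S (o := p e) Hc) => w ew nw3 nwp.
have [Epw dw] := child _ _ ew nwp.
have [/existsP[s /and3P[ws nse Ls]]|Nw] :=
  boolP [exists s, [&& w -- s, s != e & 0 < #|leaves s w|]].
  left; exists s; have [|Eps ds] := child _ _ ws; first by rewrite Epw.
  have [|||Bs wE _] := tops s w Eps; rewrite // ?ds ?dw -?dve //.
    exact: nr dw.
  rewrite Epw in wE; split=> //; rewrite ltn_neqAle Ls andbT eq_sym.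
  apply: contra N => L1; apply/existsP; exists w; apply/existsP; exists s.
  by rewrite ew nwp ws nse L1.
right; have we : w -- e by rewrite sg_sym.
split.
  split=> // y; rewrite inE => /andP[wy nye] x.
  apply/idP/eqP => [yx|->]; last by rewrite sg_sym.
  apply/eqP; apply: contraR Nw => nxw; apply/existsP; exists y.
  by rewrite wy nye; apply/card_gt0P; exists x; rewrite inE yx.
(* If [w] were a leaf, [e] would have value 2, and [v3], of value 0, would be dominated by both [v2]
   and [e]. *)
rewrite lt0n; apply/negP=> /eqP/cards0_eq L0.
have wE : leaf_at w e.
  move=> y; apply/idP/eqP => [wy|->//].
  by have [//|] := brush_nbr e wy; rewrite L0 inE.
have [_ fe] := opt_leaf S wE of_; have [f2 f3] := opt_brush S Hb L2 of_.
have [z [_ _ _ Uz]] := Pf v3 (in_setT v3) f3.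
have E2 : v2 = z by apply: Uz; rewrite // v3E eqxx.
have E3 : e = z by apply: Uz; rewrite // v3E eqxx orbT.
by rewrite E2 E3 eqxx in nv2e.
Qed.

(** * Stable trees belong to the family *)

Lemma card_embedding (H G : sgraph) (h : H -> G) (A : {set G}) :
  embedding h A -> #|H| = #|A|.
Proof.
move=> [h_inj _ memA]; rewrite -cardsT -(card_imset _ h_inj).
apply: eq_card => y; apply/imsetP/idP => [[x _ ->]|/memA[x ->]].
  by apply/memA; exists x.
by exists x.
Qed.

Lemma acyclic_induced (G : sgraph) (A : {set G}) :
  acyclic G -> acyclic (induced A).
Proof.
move=> acG c c_gt2 c_uniq.
have -> : cycle (@sedge (induced A)) c = cycle (@sedge G) (map val c).
  by case: c {c_gt2 c_uniq} => //= x c; rewrite -map_rcons path_map.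
by apply: acG; rewrite ?size_map // (map_inj_uniq val_inj).
Qed.

Section Core.
Variables (G : sgraph) (v1 v2 v3 u : G).
Hypothesis Hp : pendant v1 v2 v3 u.
Let core := ~: [set v1; v2; v3].

Lemma card_core : #|core| + 3 = #|G|.
Proof.
have [[n12 n13 n23] _ _ _] := pendant_neq Hp.
rewrite -(cardsC core) /core setCK -setUA cardsU1 cards2 !inE negb_or n12 n13.
by rewrite n23.
Qed.

Lemma is_tree_core : is_tree G -> is_tree (induced core).
Proof.
move=> [[_ cG] acG]; split; last exact: acyclic_induced.
have uC := u_core Hp; pose u' : induced core := exist _ u uC.
split=> [|x y]; first by apply/card_gt0P; exists u'.
(* rho retracts the tree onto core by collapsing the pendant path onto u. *)
pose rho z : induced core := insubd u' z.
have rhoC z : z \in core -> val (rho z) = z by exact: insubdK.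
have rhoN z : z \notin core -> rho z = u'.
  by move=> zC; apply: val_inj; rewrite val_insubd (negPf zC).
have rho_edge a b : a -- b -> connect (@sedge (induced core)) (rho a) (rho b).
  have half a' b' : a' \in core -> a' -- b' ->
      rho a' = rho b' \/ rho a' -- rho b'.
    move=> aC ab; have [bC|[Ea Eb]] := core_nbr Hp aC ab.
      by right; rewrite /= /induced_edge !rhoC.
    left; rewrite [rho b']rhoN ?Eb; first by apply: val_inj; rewrite rhoC.
    by rewrite !inE eqxx !orbT.
  move=> ab; have [aC|aC] := boolP (a \in core).
    by have [->|/connect1] := half a b aC ab.
  have [bC|bC] := boolP (b \in core); last by rewrite !rhoN.
  rewrite sg_sym in ab; have [->//|E] := half b a bC ab.
  by apply: connect1; rewrite sg_sym.
have rho_path p a : path (@sedge G) a p ->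
    connect (@sedge (induced core)) (rho a) (rho (last a p)).
  elim: p a => //= b p IH a /andP[/rho_edge ab /IH]; exact: connect_trans.
have /connectP[p pP Ey] := cG (val x) (val y).
have := rho_path _ _ pP; rewrite -Ey; congr connect.
  by apply: val_inj; rewrite rhoC //; apply: valP.
by apply: val_inj; rewrite rhoC //; apply: valP.
Qed.

Lemma pendant_siso (H : sgraph) (h : H -> G) (u0 : H) :
  embedding h core -> h u0 = u -> siso G (add_path3 u0).
Proof.
move=> hC hu; have [h_inj hE memC] := hC.
have [_ E1 E2 E3] := Hp.
have [[n12 n13 n23] m1 m2 m3] := pendant_neq Hp.
pose k (x : add_path3 u0) :=
  match x with inl a => h a | inr i => nth v3 [:: v3; v2; v1] i end.
have hP a : [/\ (h a == v1) = false, (h a == v2) = false & (h a == v3) = false].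
  have /coreP[] : h a \in core by apply/memC; exists a.
  by move=> /negPf-> /negPf-> /negPf->.
have k_inj : injective k.
  have N a i : h a <> nth v3 [:: v3; v2; v1] i.
    by have [/eqP n1 /eqP n2 /eqP n3] := hP a; case: i => [|[|[|i]]] /=; rewrite ?nth_nil.
  move=> [a|i] [b|j] //=.
  - by move/h_inj->.
  - by move/N.
  - by move/esym/N.
  move: n12 n13 n23; have [->|->|->] := ord3P i; have [->|->|->] := ord3P j => //= + + + E;
    by rewrite E eqxx.
apply: siso_sym; exists k.
  apply: inj_card_bij k_inj _; rewrite card_sum card_ord.
  by rewrite (card_embedding hC) card_core.
have edge a i : h a -- nth v3 [:: v3; v2; v1] (i : 'I_3) = (a == u0) && (i == ord0).
  have [Ea1 Ea2 Ea3] := hP a; rewrite sg_sym; have [->|->|->] := ord3P i => /=.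
  - by rewrite E3 Ea2 /= -hu (inj_eq h_inj) andbT.
  - by rewrite E2 Ea1 Ea3 andbF.
  by rewrite E1 Ea2 andbF.
move=> [a|i] [b|j] /=.
- exact: hE.
- exact: edge.
- by rewrite sg_sym; apply: edge.
have Q := (eqxx, n12, n13, n23, negPf n12, negPf n13, negPf n23, negPf m1, negPf m3).
have [->|->|->] := ord3P i; have [->|->|->] := ord3P j;
  rewrite /= ?E1 ?E2 ?E3 ?(eq_sym v2 v1) ?(eq_sym v3 v1) ?(eq_sym v3 v2) ?Q //.
Qed.
End Core.

Lemma gam_le_card (G : sgraph) (A : {set G}) : gam A <= #|A|.
Proof.
by rewrite -sum1_card; have : prd_on A (fun=> 1) by []; apply: gam_le.
Qed.

Lemma stable_family_T (T : sgraph) :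
  is_tree T -> 2 < #|T| -> prd_stable T -> family_T T.
Proof.
move En: #|T| => n; elim/ltn_ind: n T En => n IH T En tT; rewrite -En => T_gt2 /prd_stableE S.
have [/siso_path3 TP|[v1 [v2 [v3 [u Hp]]]]] := stable_tree_pendant tT T_gt2 S.
  exists 1, (fun=> T); split=> // [|[|[|i]]//].
  by exists id => //; exists id.
pose C := ~: [set v1; v2; v3]; have [SC WC] := pendant_stable_core Hp S.
have embC := embedding_val C; have cC := card_embedding embC.
have cT := card_core Hp; rewrite -/C in SC WC cT.
(* An optimal function on [C] is 0 at [u], hence 2 at some [w], so [gam C] is at least 2. Stability
   and the constant function 1 on [C :\ w] give [gam C <= #|C| - 1]. *)
have C_gt2 : 2 < #|C|.
  have [f of_] := ex_opt C; have [Pf wf] := of_.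
  have [w [wC _ fw _]] := Pf u (u_core Hp) (WC f of_).
  have := gam_le_card (C :\ w); rewrite SC // -wf (wt_setD1 f wC) fw.
  have := cardsD1 w C; rewrite wC; clear; lia.
have [k [S0 [k_gt0 S0t S01 S0k S0op]]] : family_T (induced C).
  apply: (IH #|induced C|); rewrite ?cC //.
  - by rewrite -En -cT; clear; lia.
  - exact: is_tree_core Hp tT.
  exact/(stable_gam embC).
(* The sequence building the core is continued by T itself at index [k.+1]. *)
pose S' i := if i <= k then S0 i else T.
have S'E i : i <= k -> S' i = S0 i by rewrite /S' => ->.
have S'k : S' k.+1 = T by rewrite /S' ltnn.
exists k.+1, S'; split=> //.
- move=> i /andP[i_gt0]; rewrite leq_eqVlt => /orP[/eqP->|lt_ik].
    by rewrite S'k.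
  by rewrite S'E //; apply: S0t; rewrite i_gt0.
- by rewrite S'E.
- by rewrite S'k; exists id => //; exists id.
move=> i /andP[i_gt0]; rewrite ltnS leq_eqVlt => /orP[/eqP->|lt_ik]; last first.
  by rewrite !S'E ?(ltnW lt_ik) //; apply: S0op; rewrite i_gt0.
(* [S0 k] is only isomorphic to the induced core, so the vertex [u] is pulled back along [h]. *)
rewrite S'k S'E //; have [h [l hl lh] hE] := S0k.
have hC : embedding (val \o h) C.
  split=> [x y /val_inj/(can_inj hl)//|x y|y]; first by rewrite -hE.
  split=> [yC|[x ->]]; last exact: valP.
  by exists (l (exist _ y yC)); rewrite /= lh.
pose u0 := l (exist _ u (u_core Hp)).
have hu0 : (val \o h) u0 = u by rewrite /= lh.
exists u0; last exact: (pendant_siso Hp hC hu0).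
by apply/(always0P _ hC) => f of_; rewrite hu0; apply: WC.
Qed.

Theorem theorem1 (T : sgraph) (hT : is_tree T) (hn : 3 <= #|T|) :
  prd_stable T <-> family_T T.
Proof. by split; [apply: stable_family_T | apply: family_T_stable]. Qed.
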